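(* Let $u_0(x)=\frac12$ and $u_1(x)=\sin x$ for $x\in\mathbb{R}$, and let $u\in L^\infty_{{\rm loc},t}((0,\infty);W^{1,2}_{{\rm loc},x}(\mathbb{R}))\cap W^{1,\infty}_{{\rm loc},t}((0,\infty);L^2_{{\rm loc},x}(\mathbb{R}))$ be the unique solution of the zero-obstacle problem for the wave equation $$\min\{\square u,u\}=0 \ \text{ in } \mathbb{R}\times[0,\infty),\qquad u(\cdot,0)=u_0 \ \text{ in }\mathbb{R},\qquad u_t(\cdot,0)=u_1\ \text{ a.e. in }\mathbb{R},$$ satisfying, in the sense of distributions, $\frac{d}{dx}(-2u_xu_t)+\frac{d}{dt}(u_x^2+u_t^2)=0$ in $\mathbb{R}\times(0,\infty)$. Let $w(x,t)=\frac12+\sin(x)\sin(t)$ be the free wave with the same initial data (i.e. $\square w=0$ in $\mathbb{R}\times[0,\infty)$, $w(\cdot,0)=u_0$, $w_t(\cdot,0)=u_1$). Then $u(x,t)\to\infty$ as $t\to\infty$ for every $x\in\mathbb{R}$. Consequently the formula $$u(x,t)=w(x,t)+2\sup_{(x',t')\in T^-_{x,t}}(w(x',t'))^-\qquad\text{for all }(x,t)\in\mathbb{R}\times[0,\infty)$$ does not hold for this solution.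
   Context: $\square u:=u_{tt}-u_{xx}$. The equation $\min\{\square u,u\}=0$ means: $u\ge 0$, $\square u\ge 0$ in the sense of distributions (so $\square u$ is a nonnegative measure), and $\square u=0$ in the open set $\{u>0\}$. The condition $u\in L^\infty_{{\rm loc},t}((0,\infty);W^{1,2}_{{\rm loc},x}(\mathbb{R}))\cap W^{1,\infty}_{{\rm loc},t}((0,\infty);L^2_{{\rm loc},x}(\mathbb{R}))$ means that for every compact $K\subset\mathbb{R}$ and every $T>0$ there is a constant $C(T,K)<\infty$ with $\int_K\{|u(x,t)|^2+|u_x(x,t)|^2+|u_t(x,t)|^2\}\,dx\le C(T,K)$ for a.e. $t\in(0,T)$. Known existence and uniqueness theorem (Schatzman, 1980): if $u_0\in W^{1,2}_{\rm loc}(\mathbb{R})$, $u_1\in L^2_{\rm loc}(\mathbb{R})$, $u_0\ge0$ and $u_1\ge 0$ a.e. in $\{u_0=0\}$, there exists a unique solution $u$ in this class satisfying all the listed conditions. $T^-_{x,t}:=\{(x',t')\in\mathbb{R}\times[0,\infty):|x-x'|\le t-t'\}$ is the cone of dependence of $(x,t)$, and $r^-:=\sup\{-r,0\}$ is the negative part of $r\in\mathbb{R}$. *)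

(* Defs.v *)
From mathcomp Require Import all_boot all_order all_algebra.
From mathcomp Require Import all_classical all_reals all_analysis.
Set Implicit Arguments.
Unset Strict Implicit.
Unset Printing Implicit Defensive.
Import Order.TTheory GRing.Theory Num.Theory.
Import numFieldNormedType.Exports.
Local Open Scope classical_set_scope.
Local Open Scope ring_scope.

(* A point of space-time is a pair p = (x, t), with
   x = p.1 and t = p.2; space-time functions are maps R * R -> R, of which only
   the values on t >= 0 matter. *)

Section Wave.
Context {R : realType}.
Implicit Types (u v w f g phi : R * R -> R) (W : set (R * R)).

Local Notation leb := (@lebesgue_measure R).
Local Notation leb2 := (leb \x leb)%E.
Local Notation RxR := (measurableTypeR R * measurableTypeR R)%type.

Definition e_x : R * R := (1, 0).
Definition e_t : R * R := (0, 1).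

Definition halfplane : set (R * R) := [set p | 0 < p.2].
Definition halfplane_closed : set (R * R) := [set p | 0 <= p.2].

Definition iter_partial (s : seq bool) f : R * R -> R :=
  foldr (fun (b : bool) g => 'D_(if b then e_t else e_x) g) f s.

(* C^oo: the iterated partial derivatives of all orders exist and are
   continuous. *)
Definition smooth f : Prop := forall s : seq bool,
  [/\ continuous (iter_partial s f),
      forall p, derivable (iter_partial s f) p e_x &
      forall p, derivable (iter_partial s f) p e_t].

Definition box f : R * R -> R :=
  fun p => 'D_e_t ('D_e_t f) p - 'D_e_x ('D_e_x f) p.

Definition supp f : set (R * R) := closure [set p | f p != 0].

Definition test_function W phi : Prop :=
  [/\ smooth phi, compact (supp phi) & supp phi `<=` W].

Definition pairing f phi : R := \int[leb2]_(p in halfplane) (f p * phi p).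

Definition weak_partial (e : R * R) f g : Prop :=
  forall phi, test_function halfplane phi ->
    pairing f ('D_e phi) = - pairing g phi.

Definition box_ge0 u : Prop :=
  forall phi, test_function halfplane phi -> (forall p, 0 <= phi p) ->
    0 <= pairing u (box phi).

Definition box_eq0_on W u : Prop :=
  forall phi, test_function W phi -> pairing u (box phi) = 0.

(* min{box u, u} = 0 *)
Definition zero_obstacle u : Prop :=
  [/\ forall p, halfplane_closed p -> 0 <= u p,
      box_ge0 u &
      box_eq0_on (halfplane `&` [set p | 0 < u p]) u].

(* ux and ut are the weak derivatives of u, and u belongs to
   L^oo_{loc,t}(W^{1,2}_{loc,x}) /\ W^{1,oo}_{loc,t}(L^2_{loc,x}). Elements of
   this class have a (unique) representative that is continuous up to t = 0;
   u is required to be that representative, so that its pointwise values and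
   the open set {u > 0} make sense. *)
Definition energy_class u ux ut : Prop :=
  [/\ {within halfplane_closed, continuous u},
      measurable_fun (halfplane : set RxR) ux /\
      measurable_fun (halfplane : set RxR) ut,
      weak_partial e_x u ux,
      weak_partial e_t u ut &
      forall (K : set R) (T : R), compact K -> 0 < T ->
        exists C : R, {ae leb, forall t : R, 0 < t < T ->
          (\int[leb]_(x in K)
             (`|u (x, t)| ^+ 2 + `|ux (x, t)| ^+ 2 + `|ut (x, t)| ^+ 2)%:E
           <= C%:E)%E}].

(* d/dx (-2 ux ut) + d/dt (ux^2 + ut^2) = 0 in the sense of distributions *)
Definition energy_conservation ux ut : Prop :=
  forall phi, test_function halfplane phi ->
    - pairing (fun p => - (2 * ux p * ut p)) ('D_e_x phi)
    - pairing (fun p => ux p ^+ 2 + ut p ^+ 2) ('D_e_t phi) = 0.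

(* u_t(., 0) = u1 a.e.: the derivative at t = 0 is one-sided, since u lives on
   t >= 0. *)
Definition initial_data (u0 u1 : R -> R) u : Prop :=
  (forall x, u (x, 0) = u0 x) /\
  {ae leb, forall x : R,
    (u (x, h) - u (x, 0)) / h @[h --> 0^'+] --> u1 x}.

Definition obstacle_solution (u0 u1 : R -> R) u : Prop :=
  exists ux ut : R * R -> R,
    [/\ energy_class u ux ut,
        zero_obstacle u,
        initial_data u0 u1 u &
        energy_conservation ux ut].

Definition free_wave (u0 u1 : R -> R) w : Prop :=
  [/\ smooth w,
      forall p, halfplane_closed p -> box w p = 0,
      forall x, w (x, 0) = u0 x &
      forall x, 'D_e_t w (x, 0) = u1 x].

Definition dependence_cone (p : R * R) : set (R * R) :=
  [set q | 0 <= q.2 /\ `|p.1 - q.1| <= p.2 - q.2].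

End Wave.

(* Main.v *)
Require Import Defs.
From mathcomp Require Import all_boot all_order all_algebra.
From mathcomp Require Import all_classical all_reals all_analysis.
From mathcomp Require Import measurable_realfun ring lra.
Import Order.TTheory GRing.Theory Num.Theory.
Import numFieldNormedType.Exports.
Local Open Scope classical_set_scope.
Local Open Scope ring_scope.
Set Implicit Arguments.
Unset Strict Implicit.
Unset Printing Implicit Defensive.

(** Let w be the free wave and v = u - w, so that box v >= 0 and v vanishes with
    its time derivative at t = 0. In the null coordinates a = x + t, b = x - t the
    inequality box v >= 0 says that D(b, a) := v((a + b) / 2, (a - b) / 2) satisfies
    D(b1, a1) + D(b2, a2) <= D(b1, a2) + D(b2, a1) on characteristic rectangles;
    taking the bottom corner on t = 0 makes D a superadditive function of the
    interval [b, a]. Bisecting intervals down to length 2h, where v = o(h) in L^1_loc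
    (pointwise a.e. by the initial condition, with uniform integrability from
    the L^2 bound on u_t), gives D >= 0. Finally w = -1/2 at the apex of the triangle
    with base [pi + 2 k pi, 2 pi + 2 k pi], where u >= 0 forces D >= 1/2; the dependence
    cone of (x, t) contains about t / pi of these disjoint triangles, so u grows at
    least linearly in t, whereas the right-hand side of the formula is bounded. *)

(** * Smooth functions and test functions *)

(** Superadditivity alone allows D(b, a) = b - a, which is negative; only the initial velocity
    excludes it. That velocity is prescribed almost everywhere, so it says nothing about the points
    of one given dyadic subdivision. Integrating over all translates of the interval turns the
    accumulated error into an L^1 norm, which does tend to 0, and continuity of v brings back the
    pointwise statement. The distributional conditions may be tested only with functions supported
    in t > 0, whereas the triangles and the increments start at t = 0. Every test function therefore
    stays at a positive distance above the axis, and continuity of u up to t = 0 closes the gap in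
    the limit. The test functions are finite sums and products of one-variable profiles composed
    with affine maps, so two inductively generated classes cover them all. *)

Section SmoothFunctions.
Context {R : realType}.
Implicit Types (f g : R -> R) (h k : R * R -> R) (x : R) (n : nat).

Lemma is_derive_congr {V W : normedModType R} {F G : V -> W} {p v : V} {d d' : W} :
  is_derive p v F d -> F =1 G -> d = d' -> is_derive p v G d'.
Proof. by move=> dF /funext <- <-. Qed.

(** The powers of 1/x are carried as a parameter so that the family is closed under differentiation
    up to linear combinations. *)
Definition flat_exp n x : R := if 0 < x then x^-1 ^+ n * expR (- x^-1) else 0.

(** With y = 1/x, the exponential series gives exp y >= y^(n+1)/(n+1)!; the spare power of y becomes
    the factor x that controls the behaviour at 0. *)
Lemma flat_exp_le n x : 0 < x -> x^-1 ^+ n * expR (- x^-1) <= n.+1`!%:R * x.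
Proof.
move=> x0; set y := x^-1.
have y0 : 0 < y by rewrite invr_gt0.
have H := @expR_ge1Dxn R y n (ltW y0).
rewrite expRN -[x]invrK -/y ler_pdivrMr ?expR_gt0// mulrAC ler_pdivlMr//.
rewrite -exprSr -ler_pdivrMl ?ltr0n ?fact_gt0// mulrC.
by apply: le_trans H; rewrite lerDr.
Qed.

Lemma flat_exp_norm_le n x : `|flat_exp n x| <= n.+1`!%:R * `|x|.
Proof.
rewrite /flat_exp; case: ifPn => [x0|_]; last by rewrite normr0 mulr_ge0.
rewrite (gtr0_norm x0) ger0_norm ?flat_exp_le//.
by rewrite mulr_ge0 ?expR_ge0// exprn_ge0// invr_ge0 ltW.
Qed.

Lemma is_derive_flat_exp n x : is_derive x 1 (flat_exp n)
  (flat_exp n.+2 x - n%:R * flat_exp n.+1 x).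
Proof.
have [x0|x0|->] := ltrgt0P x.
- have xn0 : x != 0 by rewrite gt_eqF.
  have H : is_derive x 1 (fun x => x^-1 ^+ n * expR (- x^-1) : R)
      (x^-1 ^+ n.+2 * expR (- x^-1) - n%:R * (x^-1 ^+ n.+1 * expR (- x^-1))).
    have dV : is_derive x 1 (fun y : R => y^-1) (- (x^-1 ^+ 2)).
      have E := @is_deriveV R id x 1 1 xn0 (is_derive_id _ _).
      by apply: (is_derive_congr E) => //; rewrite /GRing.scale/= mulr1 exprVn.
    have dN : is_derive x 1 (fun y : R => - y^-1) (x^-1 ^+ 2).
      by apply: (is_derive_congr (is_deriveN dV)) => //; rewrite opprK.
    have dE := @is_derive1_comp R expR (fun y : R => - y^-1) x _ _ (is_derive_expR _) dN.
    have dX := is_deriveX n dV.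
    apply: (is_derive_congr (is_deriveM dX dE)) => [y|]; first by rewrite !fctE.
    rewrite /GRing.scale/= fctE; set E := expR _; set y := x^-1.
    have -> : n%:R * y ^+ n.-1 * - y ^+ 2 = - (n%:R * y ^+ n.+1).
      by case: (n) => [|m]; rewrite ?mul0r ?oppr0// mulrN -mulrA -exprD addn2.
    by rewrite -[n.+2]addn2 exprD; ring.
  rewrite /flat_exp x0.
  apply: near_eq_is_derive H; near=> y.
  by rewrite ifT//; near: y; exact: lt_nbhsr.
- rewrite /flat_exp ltNge (ltW x0)/= mulr0 subr0.
  apply: (@near_eq_is_derive _ _ _ (cst 0)).
  near=> y; rewrite ltNge ifN// negbK ltW//; near: y; exact: lt_nbhsl.
- rewrite /flat_exp ltxx mulr0 subr0.
  suff H : (fun y : R => y^-1 *: (flat_exp n (y *: 1 + 0) - flat_exp n 0)) @ 0^' --> (0 : R).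
    apply: DeriveDef; first by apply/cvg_ex; exists 0; exact: H.
    exact: cvg_lim H.
  apply/cvgr0Pnorm_lt => e e0; near=> y.
  have yn0 : y != 0 by near: y; exact: nbhs_dnbhs_neq.
  rewrite addr0 /GRing.scale/= mulr1 {2}/flat_exp ltxx subr0.
  (* The difference quotient at 0 is the next member of the family, which tends to 0 by the linear
     bound. *)
  have -> : y^-1 * flat_exp n y = flat_exp n.+1 y.
    by rewrite /flat_exp; case: ifP => _; rewrite ?mulr0// exprS mulrA.
  apply: le_lt_trans (flat_exp_norm_le _ _) _.
  rewrite -ltr_pdivlMl ?ltr0n ?fact_gt0//; near: y.
  apply: dnbhs0_lt; first by rewrite mulr_gt0// invr_gt0 ltr0n fact_gt0.
Unshelve. all: by end_near. Qed.

Lemma flat_exp_ge0 n x : 0 <= flat_exp n x.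
Proof.
rewrite /flat_exp; case: ifPn => // x0.
by rewrite mulr_ge0 ?expR_ge0// exprn_ge0// invr_ge0 ltW.
Qed.

Lemma flat_exp_gt0 n x : 0 < x -> 0 < flat_exp n x.
Proof. by move=> x0; rewrite /flat_exp x0 mulr_gt0 ?expR_gt0// exprn_gt0// invr_gt0. Qed.

(* Any class of functions closed under differentiation consists of C^oo functions;
   this one is generated by what the test functions below are made of. *)
Inductive smooth1 : (R -> R) -> Prop :=
| smooth1_flat_exp n : smooth1 (flat_exp n)
| smooth1_cst (c : R) : smooth1 (cst c)
| smooth1_sin : smooth1 sin
| smooth1_cos : smooth1 cos
| smooth1D f g : smooth1 f -> smooth1 g -> smooth1 (fun x => f x + g x)
| smooth1M f g : smooth1 f -> smooth1 g -> smooth1 (fun x => f x * g x)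
| smooth1_affine (a b : R) f : smooth1 f -> smooth1 (fun x => f (a * x + b))
| smooth1V f : (forall x, f x != 0) -> smooth1 f -> smooth1 (fun x => (f x)^-1).

Lemma is_derive_affine (a b : R) x : is_derive x 1 (fun y => a * y + b) a.
Proof.
have H := is_deriveD (is_deriveZ a (is_derive_id x (1 : R))) (is_derive_cst b x 1).
by apply: (is_derive_congr H) => //; rewrite /GRing.scale/= mulr1 addr0.
Qed.

Lemma smooth1_derive f : smooth1 f ->
  exists2 g, smooth1 g & forall x, is_derive x 1 f (g x).
Proof.
elim=> {f}.
- move=> n; exists (fun x => flat_exp n.+2 x + - n%:R * flat_exp n.+1 x).
    by apply: smooth1D; [exact: smooth1_flat_exp|apply: smooth1M;
      [exact: (smooth1_cst (- n%:R))|exact: smooth1_flat_exp]].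
  by move=> x; rewrite mulNr; exact: is_derive_flat_exp.
- by move=> c; exists (cst 0); [exact: smooth1_cst|move=> x; exact: is_derive_cst].
- by exists cos; [exact: smooth1_cos|move=> x; exact: is_derive_sin].
- exists (fun x => (- 1) * sin x).
    by apply: smooth1M; [exact: (smooth1_cst (- 1))|exact: smooth1_sin].
  by move=> x; apply: is_derive_eq (is_derive_cos x) _; rewrite mulN1r.
- move=> f g _ [f' sf' df] _ [g' sg' dg].
  exists (fun x => f' x + g' x); first exact: smooth1D.
  by move=> x; exact: (is_derive_congr (is_deriveD (df x) (dg x))).
- move=> f g sf [f' sf' df] sg [g' sg' dg].
  exists (fun x => f x * g' x + f' x * g x); first by apply: smooth1D; exact: smooth1M.
  move=> x; apply: (is_derive_congr (is_deriveM (df x) (dg x))) => //.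
  by rewrite /GRing.scale/= [f' x * _]mulrC.
- move=> a b f _ [f' sf' df].
  exists (fun x => a * f' (a * x + b)).
    by apply: smooth1M; [exact: (smooth1_cst a)|exact: smooth1_affine].
  move=> x; have := @is_derive1_comp R f (fun y => a * y + b) x _ _ (df _)
    (is_derive_affine a b x).
  by move=> H; apply: (is_derive_congr H) => //; rewrite mulrC.
- move=> f f0 sf [f' sf' df].
  exists (fun x => (- 1) * ((f x)^-1 * (f x)^-1) * f' x).
    by do ?apply: smooth1M => //; [exact: (smooth1_cst (- 1))|exact: smooth1V..].
  move=> x; apply: (is_derive_congr (is_deriveV (f0 x) (df x))) => //.
  by rewrite /GRing.scale/= expr2 invfM mulN1r.
Qed.

Lemma is_derive_continuous f f' : (forall x, is_derive x 1 f (f' x)) -> continuous f.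
Proof.
move=> df x; apply: differentiable_continuous; apply/derivable1_diffP.
by have [] := df x.
Qed.

Lemma smooth1_continuous f : smooth1 f -> continuous f.
Proof. by case/smooth1_derive => f' _; exact: is_derive_continuous. Qed.

Let denom x := flat_exp 0 x + flat_exp 0 (- 1 * x + 1).

(** The numbers x and 1 - x are never both nonpositive. *)
Let denom_neq0 x : denom x != 0.
Proof.
rewrite gt_eqF// /denom; have [x0|x0] := ltP 0 x.
  by rewrite ltr_wpDr ?flat_exp_gt0 ?flat_exp_ge0.
by rewrite ltr_wpDl ?flat_exp_ge0 ?flat_exp_gt0//; lra.
Qed.

(* The derivative bump of the step sstep has unit mass and support in [0, 1]. *)
Definition sstep x : R := flat_exp 0 x * (denom x)^-1.

(** Quotient rule for q / (q + r) with q = [flat_exp 0 x] and r its reflection, written as (q' r - q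
    r') / (q + r)^2; since r' is nonpositive, sign and support can be read off. *)
Definition bump x : R :=
  (flat_exp 2 x * flat_exp 0 (- 1 * x + 1) + flat_exp 0 x * flat_exp 2 (- 1 * x + 1)) *
  ((denom x)^-1 * (denom x)^-1).

Lemma flat_exp_eq0 n x : x <= 0 -> flat_exp n x = 0.
Proof. by rewrite /flat_exp leNgt => /negbTE ->. Qed.

Lemma smooth1_sstep : smooth1 sstep.
Proof.
have s0 := smooth1_flat_exp 0.
apply: smooth1M => //; apply: smooth1V => //.
by apply: smooth1D => //; exact: (smooth1_affine (- 1) 1 s0).
Qed.

Lemma is_derive_sstep x : is_derive x 1 sstep (bump x).
Proof.
have dq (y : R) : is_derive y 1 (flat_exp 0) (flat_exp 2 y).
  by apply: (is_derive_congr (is_derive_flat_exp 0 y)) => //; rewrite mul0r subr0.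
have dr : is_derive x 1 (fun x => flat_exp 0 (- 1 * x + 1)) (- flat_exp 2 (- 1 * x + 1)).
  have := @is_derive1_comp R (flat_exp 0) _ x _ _ (dq _) (is_derive_affine (-1) 1 x).
  by move=> H; apply: (is_derive_congr H) => //; rewrite mulrN1.
have dV := is_deriveV (denom_neq0 x) (is_deriveD (dq x) dr).
apply: (is_derive_congr (is_deriveM (dq x) dV)) => //.
rewrite /GRing.scale/= /bump; move: (denom_neq0 x); rewrite /denom => dn0.
by field.
Qed.

Lemma smooth1_bump : smooth1 bump.
Proof.
have [g sg dg] := smooth1_derive smooth1_sstep.
suff -> : bump = g by [].
by apply/funext => x; have [_ <-] := is_derive_sstep x; have [_ <-] := dg x.
Qed.

Lemma bump_ge0 x : 0 <= bump x.
Proof.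
rewrite /bump mulr_ge0//; last by rewrite -expr2 sqr_ge0.
by rewrite addr_ge0// mulr_ge0// flat_exp_ge0.
Qed.

Lemma bump_le0 x : x <= 0 -> bump x = 0.
Proof. by move=> x0; rewrite /bump !(flat_exp_eq0 _ x0) !mul0r addr0 mul0r. Qed.

Lemma bump_ge1 x : 1 <= x -> bump x = 0.
Proof.
move=> x1; have x0 : - 1 * x + 1 <= 0 by lra.
by rewrite /bump !(flat_exp_eq0 _ x0) !mulr0 addr0 mul0r.
Qed.

Lemma sstep_le0 x : x <= 0 -> sstep x = 0.
Proof. by move=> x0; rewrite /sstep flat_exp_eq0// mul0r. Qed.

Lemma sstep_ge1 x : 1 <= x -> sstep x = 1.
Proof.
move=> x1; have x0 : - 1 * x + 1 <= 0 by lra.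
have := denom_neq0 x; rewrite /sstep /denom (flat_exp_eq0 _ x0) addr0.
by move=> ?; rewrite divff.
Qed.

Lemma sstep_homo : {homo sstep : x y / x <= y}.
Proof.
move=> x y xy.
apply: (@ger0_derive1_le_cc R sstep x y) => //.
- by move=> z _; have [] := is_derive_sstep z.
- by move=> z _; rewrite derive1E; have [_ ->] := is_derive_sstep z; exact: bump_ge0.
- exact/continuous_subspaceT/smooth1_continuous/smooth1_sstep.
- by rewrite in_itv/= lexx xy.
- by rewrite in_itv/= lexx xy.
Qed.

Definition sstep_at (a e x : R) := sstep (e^-1 * x + - (a / e)).

Definition bump_at (a e x : R) := e^-1 * bump (e^-1 * x + - (a / e)).

Lemma smooth1_sstep_at a e : smooth1 (sstep_at a e).
Proof. exact/smooth1_affine/smooth1_sstep. Qed.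

Lemma smooth1_bump_at a e : smooth1 (bump_at a e).
Proof.
apply: smooth1M; first exact: (smooth1_cst e^-1).
exact/smooth1_affine/smooth1_bump.
Qed.

Lemma is_derive_sstep_at a e x : is_derive x 1 (sstep_at a e) (bump_at a e x).
Proof.
have := @is_derive1_comp R sstep _ x _ _ (is_derive_sstep _)
  (is_derive_affine e^-1 (- (a / e)) x).
by move=> H; apply: (is_derive_congr H) => //; rewrite mulrC.
Qed.

Section Scaled.
Variables (a e : R).
Hypothesis e0 : 0 < e.

Lemma sstep_at_homo : {homo sstep_at a e : x y / x <= y}.
Proof.
by move=> x y xy; apply: sstep_homo; rewrite lerD2r ler_pM2l// invr_gt0.
Qed.

Lemma sstep_at_le x : x <= a -> sstep_at a e x = 0.
Proof.
by move=> xa; rewrite /sstep_at sstep_le0// mulrC -mulrBl pmulr_lle0 ?invr_gt0// subr_le0.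
Qed.

Lemma sstep_at_ge x : a + e <= x -> sstep_at a e x = 1.
Proof.
move=> xa; rewrite /sstep_at sstep_ge1// mulrC -mulrBl ler_pdivlMr// mul1r.
by rewrite lerBrDl.
Qed.

Lemma bump_at_ge0 x : 0 <= bump_at a e x.
Proof. by rewrite mulr_ge0 ?bump_ge0// invr_ge0 ltW. Qed.

Lemma bump_at_le x : x <= a -> bump_at a e x = 0.
Proof.
move=> xa; rewrite /bump_at bump_le0 ?mulr0//.
by rewrite mulrC -mulrBl pmulr_lle0 ?invr_gt0// subr_le0.
Qed.

Lemma bump_at_ge x : a + e <= x -> bump_at a e x = 0.
Proof.
move=> xa; rewrite /bump_at bump_ge1 ?mulr0//.
by rewrite mulrC -mulrBl ler_pdivlMr// mul1r lerBrDl.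
Qed.

Lemma sstep_at_ge0 x : 0 <= sstep_at a e x.
Proof.
have [xa|/ltW xa] := leP x a; first by rewrite sstep_at_le.
by rewrite -[leLHS](sstep_at_le (lexx a)) sstep_at_homo.
Qed.

Lemma sstep_at_le1 x : sstep_at a e x <= 1.
Proof.
have [xa|/ltW xa] := leP (a + e) x; first by rewrite sstep_at_ge.
by rewrite -[leRHS](sstep_at_ge (lexx (a + e))) sstep_at_homo.
Qed.

Lemma integral_bump_at b d : b <= a -> a + e <= d ->
  (\int[@lebesgue_measure R]_(x in `[b, d]) (bump_at a e x)%:E = 1)%E.
Proof.
move=> ba ad.
rewrite (@continuous_FTC2 _ _ (sstep_at a e)).
- by rewrite sstep_at_ge// sstep_at_le// sube0.
- by apply: le_lt_trans ba _; apply: lt_le_trans ad; rewrite ltrDl.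
- exact/continuous_subspaceT/smooth1_continuous/smooth1_bump_at.
- have cS := smooth1_continuous (smooth1_sstep_at a e).
  split; last 2 first.
  + by apply: cvg_at_right_filter; exact: cS.
  + by apply: cvg_at_left_filter; exact: cS.
  by move=> x _; have [] := is_derive_sstep_at a e x.
- by move=> x _; rewrite derive1E; have [_ ->] := is_derive_sstep_at a e x.
Qed.

End Scaled.

Lemma bump_at_neq0 a e x : 0 < e -> bump_at a e x != 0 -> a < x < a + e.
Proof.
move=> e0; apply: contra_neqT; rewrite negb_and -!leNgt => /orP[|].
  exact: bump_at_le.
exact: bump_at_ge.
Qed.

(** Affine arguments cover at once the products in null coordinates ([lcprod]) and the products of a
    function of x with a function of t. *)
Inductive smooth2 : (R * R -> R) -> Prop :=
| smooth2_affine (a b c : R) f : smooth1 f ->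
    smooth2 (fun p => f (a * p.1 + b * p.2 + c))
| smooth2D h k : smooth2 h -> smooth2 k -> smooth2 (fun p => h p + k p)
| smooth2M h k : smooth2 h -> smooth2 k -> smooth2 (fun p => h p * k p).

Lemma smooth2_cst (c : R) : smooth2 (cst c).
Proof. exact: (@smooth2_affine 0 0 0 (cst c) (smooth1_cst c)). Qed.

(** On the line through p in direction v the function is h |-> f (m h + l), so the one-variable
    chain rule applies. *)
Lemma is_derive_affine2 (a b c : R) f (df : R) (p v : R * R) :
  is_derive (a * p.1 + b * p.2 + c) 1 f df ->
  is_derive p v (fun q => f (a * q.1 + b * q.2 + c)) ((a * v.1 + b * v.2) * df).
Proof.
move=> H; set m := a * v.1 + b * v.2; set l := a * p.1 + b * p.2 + c.
have dA := is_derive_affine m l 0.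
rewrite -/l in H.
have {}H : is_derive (m * 0 + l) 1 f df by rewrite mulr0 add0r.
have D := @is_derive1_comp R f _ 0 _ _ H dA.
have E : (fun h : R => f (a * (h *: v + p).1 + b * (h *: v + p).2 + c)) =
         f \o (fun y => m * y + l).
  by apply/funext => y /=; congr f; rewrite /m /l /GRing.scale/=; ring.
apply: DeriveDef.
  by apply/derivable1P; rewrite E; case: D.
have [_ D1] := D; rewrite mulrC -D1.
rewrite /derive.
set F := fun y => _ *: _; set G := fun y => _ *: _.
suff -> : F = G by [].
apply/funext => y; rewrite /F /G /= addr0 mulr0 add0r -/l.
by congr (_ *: (f _ - _)); rewrite /m /l /GRing.scale/=; ring.
Qed.

Lemma smooth2_partial (v : R * R) h : smooth2 h ->
  exists2 k, smooth2 k & forall p, is_derive p v h (k p).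
Proof.
elim=> {h}.
- move=> a b c f /smooth1_derive[f' sf' df].
  exists (fun p => (a * v.1 + b * v.2) * f' (a * p.1 + b * p.2 + c)).
    by apply: smooth2M; [exact: (smooth2_cst (a * v.1 + b * v.2))|exact: smooth2_affine].
  by move=> p; exact: is_derive_affine2.
- move=> h k _ [h' sh' dh] _ [k' sk' dk].
  exists (fun p => h' p + k' p); first exact: smooth2D.
  by move=> p; exact: (is_derive_congr (is_deriveD (dh p) (dk p))).
- move=> h k sh [h' sh' dh] sk [k' sk' dk].
  exists (fun p => h p * k' p + h' p * k p); first by apply: smooth2D; exact: smooth2M.
  move=> p; apply: (is_derive_congr (is_deriveM (dh p) (dk p))) => //.
  by rewrite /GRing.scale/= [h' p * _]mulrC.
Qed.

Lemma continuous_fst2 : continuous (fun p : R * R => p.1).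
Proof. by move=> p; exact: cvg_fst. Qed.

Lemma continuous_snd2 : continuous (fun p : R * R => p.2).
Proof. by move=> p; exact: cvg_snd. Qed.

Lemma continuous_affine2 (a b c : R) :
  continuous (fun p : R * R => a * p.1 + b * p.2 + c).
Proof.
move=> p; apply: cvgD; last exact: cvg_cst.
by apply: cvgD; apply: cvgMr; [exact: continuous_fst2|exact: continuous_snd2].
Qed.

Lemma smooth2_continuous h : smooth2 h -> continuous h.
Proof.
elim=> {h}.
- move=> a b c f /smooth1_continuous cf p.
  apply: (@continuous_comp _ _ _ (fun p : R * R => a * p.1 + b * p.2 + c) f);
    [exact: continuous_affine2|exact: cf].
- by move=> h k _ ch _ ck p; exact: (cvgD (ch p) (ck p)).
- by move=> h k _ ch _ ck p; exact: (cvgM (ch p) (ck p)).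
Qed.

Lemma smooth2_smooth h : smooth2 h -> smooth h.
Proof.
move=> sh s.
have {sh} : smooth2 (iter_partial s h).
  elim: s => [//|b s /(smooth2_partial (if b then e_t else e_x))[k sk dk]] /=.
  suff -> : 'D_(if b then e_t else e_x) (iter_partial s h) = k by [].
  by apply/funext => p; have [] := dk p.
move=> sh; split; first exact: smooth2_continuous.
- by move=> p; have [k _ dk] := smooth2_partial e_x sh; case: (dk p).
- by move=> p; have [k _ dk] := smooth2_partial e_t sh; case: (dk p).
Qed.

End SmoothFunctions.

(** * Measurability and integrability in the plane *)

Section PlaneIntegrals.
Context {R : realType}.
Implicit Types (f g : R -> R) (h k : R * R -> R).

Local Notation mu := (@lebesgue_measure R).
Local Notation mu2 := (mu \x mu)%E.
Local Notation RxR := (measurableTypeR R * measurableTypeR R)%type.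

Definition box_set (a b c d : R) : set (R * R) := `[a, b]%classic `*` `[c, d]%classic.

Lemma compact_box_set a b c d : compact (box_set a b c d).
Proof. by apply: compact_setX; exact: segment_compact. Qed.

Lemma test_function_box a b c d h : smooth2 h -> 0 < c ->
  (forall p, h p != 0 -> box_set a b c d p) -> test_function halfplane h.
Proof.
move=> sh c0 hbox.
have cl : closed (box_set a b c d).
  by apply: compact_closed (@compact_box_set a b c d); exact: norm_hausdorff.
have sub : supp h `<=` box_set a b c d.
  by rewrite [X in _ `<=` X](closure_id _).1//; exact: closureS.
split; first exact: smooth2_smooth.
- apply: subclosed_compact sub; first exact: closed_closure.
  exact: compact_box_set.
- move=> p /sub[_]/=; rewrite in_itv/= => /andP[cp _].
  exact: lt_le_trans cp.
Qed.

(** Continuity refers to the product topology, the integrals to the product sigma-algebra. They are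
    reconciled by writing O as a countable union of squares with rational centres and radii
    1/(n+1). *)
Lemma open_measurable2 (O : set (R * R)) : open O -> measurable (O : set RxR).
Proof.
move=> oO.
pose B (i : rat * rat * nat) : set (R * R) :=
  ball (ratr i.1.1 : R) (i.2.+1%:R^-1 : R) `*` ball (ratr i.1.2 : R) (i.2.+1%:R^-1 : R).
have -> : O = \bigcup_(i in [set i | B i `<=` O]) B i.
  apply/seteqP; split=> [p Op|p [i /= iO]]; last exact: iO.
  have /nbhs_ballP[e e0 pO] : nbhs p O by exact: open_nbhs_nbhs.
  have [n] : exists n : nat, n.+1%:R^-1 < e / 2.
    have := @near_infty_natSinv_lt R (PosNum (divr_gt0 e0 (ltr0n R 2))).
    by case=> n _ /(_ n (leqnn n)); exists n.
  set r : R := n.+1%:R^-1 => re.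
  have r0 : 0 < r by rewrite invr_gt0.
  have ratP (x : R) : exists q : rat, ball (ratr q : R) r x.
    have xr : x - r < x + r by lra.
    have [q] := rat_in_itvoo xr; rewrite in_itv/= => /andP[q1 q2].
    by exists q; rewrite /ball/= ltr_norml; apply/andP; split; lra.
  have [q1 Hq1] := ratP p.1; have [q2 Hq2] := ratP p.2.
  exists (q1, q2, n) => //= z [/= z1 z2]; apply: pO.
  have rr : r + r <= e by lra.
  by split; apply: (le_ball rr); [apply: ball_triangle z1|apply: ball_triangle z2];
    exact: ball_sym.
rewrite bigcup_mkcond; apply: countable_bigcupT_measurable => // i.
case: ifPn => // _; apply: measurableX; by apply: open_measurable; apply: ball_open; rewrite invr_gt0.
Qed.

Lemma continuous2_measurable h : continuous h -> measurable_fun setT (h : RxR -> R).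
Proof.
move=> /continuousP ch; apply: (measurability _ (RGenOpens.measurableE R)).
move=> _ [_ [a [b ->] <-]]; rewrite setTI; apply: open_measurable2.
exact/ch/interval_open.
Qed.

Lemma integrable_box a b c d h : continuous h ->
  (forall p, h p != 0 -> box_set a b c d p) -> mu2.-integrable setT (EFin \o h).
Proof.
move=> ch hbox.
have mB : measurable (box_set a b c d : set RxR) by exact: measurableX.
have -> : EFin \o h = (EFin \o h) \_ (box_set a b c d).
  apply/funext => p; rewrite patchE; case: ifPn => // /negP pB /=.
  by congr EFin; apply/eqP/negPn/negP => /hbox/mem_set.
apply: (@integrable_mkcond _ RxR R mu2 _ (EFin \o h) mB).1.
apply: (@measurable_bounded_integrable _ RxR R mu2 h _ mB).
- rewrite -[X in (X < _)%E]/((mu \x mu)%E (_ `*` _)) product_measure1E//.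
  have fin (x y : R) : (mu `[x, y] < +oo)%E.
    by apply: compact_finite_measure; exact: segment_compact.
  by apply: lte_mul_pinfty => //; [rewrite ge0_fin_numE//; exact: fin|exact: fin].
- by apply: measurable_funTS; exact: continuous2_measurable.
- have /compact_bounded[M [_ Mh]] :
    compact (h @` box_set a b c d).
    apply: continuous_compact; last exact: compact_box_set.
    exact: continuous_subspaceT.
  by exists M; split; rewrite ?num_real// => x Mx y By; apply: (Mh x) => //; exists y.
Qed.

(** Replaces the half-plane by the whole plane, where Fubini and translation of variables are
    available. *)
Lemma pairing_box a b c d h k : 0 < c ->
  (forall p, k p != 0 -> box_set a b c d p) ->
  pairing h k = \int[mu2]_p (h p * k p).
Proof.
move=> c0 kbox; rewrite /pairing Rintegral_mkcond; apply: eq_Rintegral => p _.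
rewrite patchE; case: ifPn => // /negP ph.
suff -> : k p = 0 by rewrite mulr0.
apply/eqP/negPn/negP => /kbox[_]/=; rewrite in_itv/= => /andP[cp _].
by apply: ph; rewrite inE /halfplane/=; exact: lt_le_trans cp.
Qed.

End PlaneIntegrals.

(** * Nonnegative distributional d'Alembertian and characteristic rectangles *)

Section LightCone.
Context {R : realType}.
Implicit Types (f g : R -> R) (h k : R * R -> R).

Local Notation mu := (@lebesgue_measure R).
Local Notation mu2 := (mu \x mu)%E.
Local Notation RxR := (measurableTypeR R * measurableTypeR R)%type.

Lemma ge0_integral_affine (al be : R) f : 0 < al -> continuous f ->
  (forall x, 0 <= f x) ->
  (\int[mu]_x (f x)%:E = \int[mu]_x (f (al * x + be) * al)%:E)%E.
Proof.
move=> al0 cf f0.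
have d : derive1 (fun x => al * x + be) = cst al.
  by apply/funext => x; rewrite derive1E; have [_ ->] := is_derive_affine al be x.
rewrite (@increasing_ge0_integration_by_substitutionT _ (fun x => al * x + be) f)//.
- by apply: eq_integral => x _; rewrite d.
- by move=> x y xy; rewrite ltrD2r ltr_pM2l.
- by rewrite d => x; exact: cst_continuous.
- by rewrite d; exact: is_cvg_cst.
- by rewrite d; exact: is_cvg_cst.
- apply/cvgrNyPle => A; near=> x; rewrite -lerBrDr -ler_pdivlMl//.
- apply/cvgryPge => A; near=> x; rewrite -lerBlDr -ler_pdivrMl//.
Unshelve. all: by end_near. Qed.

Lemma ge0_integral_scale (c : R) f : 0 <= c -> continuous f -> (forall x, 0 <= f x) ->
  (\int[mu]_x (c * f x)%:E = c%:E * \int[mu]_x (f x)%:E)%E.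
Proof.
move=> c0 cf f0; under eq_integral do rewrite EFinM.
rewrite ge0_integralZl//.
- by apply/measurable_EFinP; exact: continuous_measurable_fun.
- by move=> x _; rewrite lee_fin.
Qed.

Lemma integral_bump_atT a e : 0 < e -> (\int[mu]_x (bump_at a e x)%:E = 1)%E.
Proof.
move=> e0; rewrite -(@integral_bump_at R a e e0 a (a + e))// [RHS]integral_mkcond.
apply: eq_integral => x _; rewrite patchE; case: ifPn => // /negP xI.
have [->//|/(bump_at_neq0 e0)/andP[ax xa]] := eqVneq (bump_at a e x) 0.
 by exfalso; apply: xI; rewrite inE/= in_itv/= !ltW//.
Qed.

Definition lcprod f g : R * R -> R := fun p => f (p.1 + p.2) * g (p.1 - p.2).

Lemma smooth2_lcprod f g : smooth1 f -> smooth1 g -> smooth2 (lcprod f g).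
Proof.
move=> sf sg.
have -> : lcprod f g =
    (fun p => f (1 * p.1 + 1 * p.2 + 0) * g (1 * p.1 + (- 1) * p.2 + 0)).
  by apply/funext => p; rewrite /lcprod !mul1r !addr0 mulN1r.
by apply: smooth2M; exact: smooth2_affine.
Qed.

Lemma is_derive_lcprod (v p : R * R) f f' g g' :
  (forall x : R, is_derive x 1 f (f' x)) -> (forall x : R, is_derive x 1 g (g' x)) ->
  is_derive p v (lcprod f g)
    ((v.1 + v.2) * lcprod f' g p + (v.1 - v.2) * lcprod f g' p).
Proof.
move=> df dg.
have F := is_derive_affine2 v (df (1 * p.1 + 1 * p.2 + 0)).
have G := is_derive_affine2 v (dg (1 * p.1 + (- 1) * p.2 + 0)).
apply: (is_derive_congr (is_deriveM F G)) => [q|].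
  by rewrite /lcprod fctE !mul1r !addr0 mulN1r.
by rewrite /lcprod /GRing.scale/= !mul1r !addr0 !mulN1r; ring.
Qed.

(** In the coordinates a = x + t, b = x - t the d'Alembertian is -4 times the mixed derivative in a
    and b. *)
Lemma box_lcprod f f' f'' g g' g'' :
  (forall x : R, is_derive x 1 f (f' x)) -> (forall x : R, is_derive x 1 f' (f'' x)) ->
  (forall x : R, is_derive x 1 g (g' x)) -> (forall x : R, is_derive x 1 g' (g'' x)) ->
  box (lcprod f g) = fun p => - 4 * lcprod f' g' p.
Proof.
move=> df df' dg dg'.
have D v : 'D_v (lcprod f g) =
    fun p => (v.1 + v.2) * lcprod f' g p + (v.1 - v.2) * lcprod f g' p.
  by apply/funext => p; have [_ ->] := is_derive_lcprod v p df dg.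
have DD v p : 'D_v ('D_v (lcprod f g)) p =
    (v.1 + v.2) * ((v.1 + v.2) * lcprod f'' g p + (v.1 - v.2) * lcprod f' g' p) +
    (v.1 - v.2) * ((v.1 + v.2) * lcprod f' g' p + (v.1 - v.2) * lcprod f g'' p).
  rewrite D.
  have A := is_deriveZ (v.1 + v.2) (is_derive_lcprod v p df' dg).
  have B := is_deriveZ (v.1 - v.2) (is_derive_lcprod v p df dg').
  by have [_ <-] := is_derive_congr (is_deriveD A B) (fun=> erefl) erefl.
by apply/funext => p; rewrite /box !DD /e_x /e_t/=; ring.
Qed.

Lemma continuous_lcprod f g : continuous f -> continuous g -> continuous (lcprod f g).
Proof.
move=> cf cg p; apply: cvgM.
  apply: (@continuous_comp _ _ _ (fun p : R * R => p.1 + p.2) f); last exact: cf.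
  by apply: cvgD; [exact: continuous_fst2|exact: continuous_snd2].
apply: (@continuous_comp _ _ _ (fun p : R * R => p.1 - p.2) g); last exact: cg.
by apply: cvgB; [exact: continuous_fst2|exact: continuous_snd2].
Qed.

(* The linear map (x, t) |-> (x + t, x - t) has determinant -2. *)
Lemma integral_lcprod_bump a b e : 0 < e ->
  (\int[mu2]_p (lcprod (bump_at a e) (bump_at b e) p)%:E = 2^-1%:E)%E.
Proof.
move=> e0.
have cb c : continuous (bump_at c e : R -> R).
  exact/smooth1_continuous/smooth1_bump_at.
have b0 c x : 0 <= bump_at c e x by exact: bump_at_ge0.
(* The integrand after the shear x -> x + t, performed for each fixed t by Tonelli; the remaining
   scaling by 2 in t produces the factor 1/2. *)
pose k p := bump_at a e (p.1 + 2 * p.2) * bump_at b e p.1.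
have ck : continuous k.
  move=> p; apply: cvgM.
    apply: (@continuous_comp _ _ _ (fun p : R * R => p.1 + 2 * p.2)); last exact: cb.
    by apply: cvgD; [exact: continuous_fst2|apply: cvgMr; exact: continuous_snd2].
  by apply: (@continuous_comp _ _ _ (fun p : R * R => p.1));
    [exact: continuous_fst2|exact: cb].
have meas (h : R * R -> R) : continuous h -> measurable_fun setT (EFin \o h : RxR -> \bar R).
  by move=> ch; apply/measurable_EFinP; exact: continuous2_measurable.
rewrite [LHS](fubini_tonelli2 (m1 := mu) (m2 := mu)
  (EFin \o lcprod (bump_at a e) (bump_at b e))); last 2 first.
- by apply: meas; exact: continuous_lcprod.
- by move=> p; rewrite lee_fin mulr_ge0.
transitivity (\int[mu]_t \int[mu]_x (k (x, t))%:E)%E.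
  apply: eq_integral => t _; rewrite /fubini_G/=.
  have ckt : continuous (fun x => k (x, t)).
    move=> x; apply: cvgM; last exact: cb.
    apply: (@continuous_comp _ _ _ (fun x => x + 2 * t)); last exact: cb.
    by apply: cvgD; [exact: cvg_id|exact: cvg_cst].
  rewrite [RHS](@ge0_integral_affine 1 (- t))//; last by move=> x; rewrite mulr_ge0.
  by apply: eq_integral => x _; rewrite /k /lcprod/= mulr1 mul1r;
    congr (bump_at a e _ * _)%:E; ring.
rewrite -[LHS](fubini_tonelli (m1 := mu) (m2 := mu) (EFin \o k)); last 2 first.
- exact: meas.
- by move=> p; rewrite lee_fin mulr_ge0.
have cax (x : R) : continuous (fun t : R => bump_at a e (2 * t + x)).
  move=> t; apply: (@continuous_comp _ _ _ (fun t : R => 2 * t + x) (bump_at a e)); last exact: cb.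
  by apply: cvgD; [apply: cvgMr; exact: cvg_id|exact: cvg_cst].
transitivity (\int[mu]_x (2^-1 * bump_at b e x)%:E)%E; last first.
  by rewrite ge0_integral_scale// ?integral_bump_atT// ?mule1// invr_ge0.
apply: eq_integral => x _.
transitivity (\int[mu]_t ((bump_at b e x / 2) * (bump_at a e (2 * t + x) * 2))%:E)%E.
  apply: eq_integral => t _; rewrite /k/=; congr EFin.
  by rewrite [x + _]addrC; field.
rewrite ge0_integral_scale//.
- by rewrite -ge0_integral_affine ?integral_bump_atT// mule1 mulrC.
- by rewrite divr_ge0.
- by move=> t; apply: cvgM; [exact: cax|exact: cvg_cst].
- by move=> t; rewrite mulr_ge0.
Qed.

(** The difference is the integral of (h - A) k, and h is within del of A wherever the nonnegative
    kernel k of mass m is nonzero. *)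
Lemma kernel_average (a b c d del A m : R) h k : continuous h -> continuous k ->
  (forall p, k p != 0 -> box_set a b c d p) -> (forall p, 0 <= k p) ->
  \int[mu2]_p k p = m ->
  (forall p, k p != 0 -> `|h p - A| <= del) ->
  `|\int[mu2]_p (h p * k p) - A * m| <= del * m.
Proof.
move=> ch ck kbox k0 <- hA.
have int (g : R * R -> R) : continuous g ->
    mu2.-integrable setT (EFin \o (fun p => g p * k p)).
  move=> cg; apply: (@integrable_box R a b c d).
    by move=> p; apply: cvgM; [exact: cg|exact: ck].
  by move=> p; rewrite mulf_eq0 negb_or => /andP[_]; exact: kbox.
have ik := @integrable_box R a b c d k ck kbox.
have ck' : continuous (fun p => h p - A) by move=> p; apply: cvgB; [exact: ch|exact: cvg_cst].
rewrite -RintegralZl// -RintegralB//; [|exact: int|exact: (int (cst A) (@cst_continuous _ _ _))].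
rewrite (@eq_Rintegral _ _ _ mu2 _ (fun p => (h p - A) * k p)); last first.
  by move=> p _; rewrite mulrBl.
apply: le_trans (le_normr_Rintegral _ _) _ => //; first exact: int.
rewrite -RintegralZl//; apply: le_Rintegral => //.
- apply: (@integrable_box R a b c d (fun p => `|(h p - A) * k p|)).
    move=> p; apply: (@continuous_comp _ _ _ (fun p => (h p - A) * k p) Num.norm).
      by apply: cvgM; [exact: ck'|exact: ck].
    exact: norm_continuous.
  by move=> p; rewrite normr_eq0 mulf_eq0 negb_or => /andP[_]; exact: kbox.
- exact: (int (cst del) (@cst_continuous _ _ _)).
- move=> p _; rewrite normrM (ger0_norm (k0 p)).
  by have [->|/hA ?] := eqVneq (k p) 0; rewrite ?mulr0// ler_wpM2r.
Qed.

End LightCone.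

Section NullRectangle.
Context {R : realType}.
Implicit Types (f g : R -> R) (h k : R * R -> R).

Local Notation mu := (@lebesgue_measure R).
Local Notation mu2 := (mu \x mu)%E.

(* The point with x + t = a and x - t = b is the apex of the characteristic
   triangle with base [b, a] on the axis t = 0. *)
Definition apex h (b a : R) : R := h ((a + b) / 2, (a - b) / 2).

Lemma null_coord_box (a1 a2 b1 b2 : R) (p : R * R) :
  a1 <= p.1 + p.2 <= a2 -> b1 <= p.1 - p.2 <= b2 ->
  box_set ((a1 + b1) / 2) ((a2 + b2) / 2) ((a1 - b2) / 2) ((a2 - b1) / 2) p.
Proof.
by move=> /andP[? ?] /andP[? ?]; split; rewrite /= in_itv/=; apply/andP; split; lra.
Qed.

Lemma Rintegral_second_difference d (T : measurableType d)
    (nu : {measure set T -> \bar R}) (c : R) (f1 f2 f3 f4 : T -> R) :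
  nu.-integrable setT (EFin \o f1) -> nu.-integrable setT (EFin \o f2) ->
  nu.-integrable setT (EFin \o f3) -> nu.-integrable setT (EFin \o f4) ->
  \int[nu]_x (c * ((f1 x + f2 x) - (f3 x + f4 x))) =
  c * ((\int[nu]_x f1 x + \int[nu]_x f2 x) - (\int[nu]_x f3 x + \int[nu]_x f4 x)).
Proof.
move=> i1 i2 i3 i4.
have i12 := integrableD measurableT i1 i2; have i34 := integrableD measurableT i3 i4.
rewrite RintegralZl//; last exact: (integrableB measurableT i12 i34).
by rewrite RintegralB// !RintegralD.
Qed.

(** The kernel concentrates at the point with null coordinates (a, b); its mass 1/2 is the Jacobian
    factor. *)
Lemma lcprod_bump_average h (a b del : R) : continuous h -> 0 < del ->
  \forall e \near 0^'+,
    `|\int[mu2]_p (h p * lcprod (bump_at a e) (bump_at b e) p) - apex h b a * 2^-1|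
    <= del * 2^-1.
Proof.
move=> ch del0.
have /cvgrPdist_le/(_ _ del0)/nbhs_ballP[r r0 hr] := ch ((a + b) / 2, (a - b) / 2).
near=> e.
have e0 : 0 < e by near: e; exact: nbhs_right_gt.
have er : e <= r by near: e; exact: nbhs_right_le.
have supp_ab p : lcprod (bump_at a e) (bump_at b e) p != 0 ->
    (a < p.1 + p.2 < a + e) /\ (b < p.1 - p.2 < b + e).
  by rewrite mulf_eq0 negb_or => /andP[/(bump_at_neq0 e0) ? /(bump_at_neq0 e0) ?].
have cb c : continuous (bump_at c e : R -> R).
  exact/smooth1_continuous/smooth1_bump_at.
apply: (@kernel_average _ ((a + b) / 2) ((a + e + (b + e)) / 2)
  ((a - (b + e)) / 2) ((a + e - b) / 2)) => //.
- exact: continuous_lcprod.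
- by move=> p /supp_ab[/andP[? ?] /andP[? ?]]; apply: null_coord_box; rewrite !ltW.
- by move=> p; rewrite mulr_ge0 ?bump_at_ge0.
- by rewrite /Rintegral integral_lcprod_bump.
- move=> p /supp_ab[/andP[? ?] /andP[? ?]].
  rewrite distrC; apply: hr; split; rewrite /ball/= ltr_norml; apply/andP; split; lra.
Unshelve. all: by end_near. Qed.

Lemma smooth1B f g : smooth1 f -> smooth1 g -> smooth1 (fun x => f x - g x).
Proof.
move=> sf sg; have -> : (fun x => f x - g x) = (fun x => f x + (- 1) * g x).
  by apply/funext => x; rewrite mulN1r.
by apply: smooth1D => //; apply: smooth1M => //; exact: (smooth1_cst (- 1)).
Qed.

Lemma sstep_at_anti (a b e x : R) : 0 < e -> a <= b -> sstep_at b e x <= sstep_at a e x.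
Proof.
move=> e0 ab; apply: sstep_homo; rewrite lerD2l lerN2 ler_pM2r// invr_gt0//.
Qed.

Section Plateau.
Variables (a b e : R).
Hypotheses (ab : a <= b) (e0 : 0 < e).

(** Both steps have the same width e, so the derivative is a difference of two unit-mass bumps, one
    just after each endpoint. *)
Definition plateau x : R := sstep_at a e x - sstep_at b e x.
Definition dplateau x : R := bump_at a e x - bump_at b e x.

Lemma smooth1_plateau : smooth1 plateau.
Proof. by apply: smooth1B; exact: smooth1_sstep_at. Qed.

Lemma smooth1_dplateau : smooth1 dplateau.
Proof. by apply: smooth1B; exact: smooth1_bump_at. Qed.

Lemma is_derive_plateau (x : R) : is_derive x 1 plateau (dplateau x).
Proof.
exact: (is_derive_congr (is_deriveB (is_derive_sstep_at a e x) (is_derive_sstep_at b e x))).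
Qed.

Lemma plateau_ge0 x : 0 <= plateau x.
Proof. by rewrite subr_ge0 sstep_at_anti. Qed.

Lemma plateau_le1 x : plateau x <= 1.
Proof. by rewrite lerBlDr ler_wpDr ?sstep_at_ge0 ?sstep_at_le1. Qed.

Lemma plateau_neq0 x : plateau x != 0 -> a < x < b + e.
Proof.
apply: contra_neqT; rewrite negb_and -!leNgt /plateau => /orP[xa|xb].
  by rewrite !sstep_at_le ?subrr// (le_trans xa).
by rewrite !sstep_at_ge ?subrr// (le_trans _ xb)// lerD2r.
Qed.

Lemma dplateau_neq0 x : dplateau x != 0 -> a < x < b + e.
Proof.
apply: contra_neqT; rewrite negb_and -!leNgt /dplateau => /orP[xa|xb].
  by rewrite !bump_at_le ?subrr// (le_trans xa).
by rewrite !bump_at_ge ?subrr// (le_trans _ xb)// lerD2r.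
Qed.

End Plateau.

(* Test box h >= 0 against F(x + t) G(x - t), where F and G are mollified
   indicators of [a1, a2] and [b1, b2]: box (F G) = - 4 F' G' concentrates at the
   four corners of the characteristic rectangle. *)
Lemma null_rectangle h (a1 a2 b1 b2 : R) : continuous h -> box_ge0 h ->
  a1 <= a2 -> b1 <= b2 -> b2 < a1 ->
  apex h b1 a1 + apex h b2 a2 <= apex h b1 a2 + apex h b2 a1.
Proof.
move=> ch hbox a12 b12 b2a1.
apply/ler_addgt0Pr => del del0.
(* Four corners, each contributing an error del/8 on half the value of h, that is del/4 on the value
   itself. *)
have d4 : 0 < del / 4 by rewrite divr_gt0.
pose K' e a b := \int[mu2]_p (h p * lcprod (bump_at a e) (bump_at b e) p).
near (0 : R)^'+ => e.
have e0 : 0 < e by near: e; exact: nbhs_right_gt.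
(* The lowest time in the support is at least (a1 - (b2 + e)) / 2, which this choice keeps
   positive. *)
have eab : e <= (a1 - b2) / 2 by near: e; apply: nbhs_right_le; rewrite divr_gt0// subr_gt0.
have E11 : `|K' e a1 b1 - apex h b1 a1 * 2^-1| <= del / 4 * 2^-1.
  by near: e; exact: (lcprod_bump_average a1 b1 ch d4).
have E12 : `|K' e a1 b2 - apex h b2 a1 * 2^-1| <= del / 4 * 2^-1.
  by near: e; exact: (lcprod_bump_average a1 b2 ch d4).
have E21 : `|K' e a2 b1 - apex h b1 a2 * 2^-1| <= del / 4 * 2^-1.
  by near: e; exact: (lcprod_bump_average a2 b1 ch d4).
have E22 : `|K' e a2 b2 - apex h b2 a2 * 2^-1| <= del / 4 * 2^-1.
  by near: e; exact: (lcprod_bump_average a2 b2 ch d4).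
pose K := K' e.
suff : K a1 b1 + K a2 b2 <= K a1 b2 + K a2 b1.
  move: E11 E12 E21 E22; rewrite -/K.
  move: (K a1 b1) (K a1 b2) (K a2 b1) (K a2 b2) => k11 k12 k21 k22.
  move: (apex h b1 a1) (apex h b2 a1) (apex h b1 a2) (apex h b2 a2) => u11 u12 u21 u22.
  rewrite !ler_norml.
  by move=> /andP[? ?] /andP[? ?] /andP[? ?] /andP[? ?] ?; lra.
pose F := plateau a1 a2 e; pose G := plateau b1 b2 e.
pose F' := dplateau a1 a2 e; pose G' := dplateau b1 b2 e.
have sF : smooth1 F := smooth1_plateau a1 a2 e.
have sG : smooth1 G := smooth1_plateau b1 b2 e.
have [F'' _ dF'] := smooth1_derive (smooth1_dplateau a1 a2 e).
have [G'' _ dG'] := smooth1_derive (smooth1_dplateau b1 b2 e).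
have Bp p : a1 < p.1 + p.2 < a2 + e -> b1 < p.1 - p.2 < b2 + e ->
    box_set ((a1 + b1) / 2) ((a2 + e + (b2 + e)) / 2)
      ((a1 - (b2 + e)) / 2) ((a2 + e - b1) / 2) p.
  by move=> /andP[? ?] /andP[? ?]; apply: null_coord_box; rewrite !ltW.
have c0 : 0 < (a1 - (b2 + e)) / 2 by clear -e0 eab b2a1; lra.
have boxE := box_lcprod (is_derive_plateau a1 a2 e) dF' (is_derive_plateau b1 b2 e) dG'.
have : 0 <= pairing h (box (lcprod F G)).
  apply: hbox; last by move=> p; rewrite mulr_ge0// plateau_ge0.
  apply: (@test_function_box _ ((a1 + b1) / 2) ((a2 + e + (b2 + e)) / 2) _ _ _ _ c0).
    exact: smooth2_lcprod.
  move=> p; rewrite mulf_eq0 negb_or => /andP[].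
  by move=> /(plateau_neq0 a12 e0) ? /(plateau_neq0 b12 e0) ?; exact: Bp.
rewrite boxE (@pairing_box _ ((a1 + b1) / 2) ((a2 + e + (b2 + e)) / 2) _ ((a2 + e - b1) / 2) _ _ c0); last first.
  move=> p; rewrite mulf_eq0 negb_or => /andP[_].
  rewrite mulf_eq0 negb_or => /andP[].
  by move=> /(dplateau_neq0 a12 e0) ? /(dplateau_neq0 b12 e0) ?; exact: Bp.
have int a b : (a1 <= a <= a2) -> (b1 <= b <= b2) ->
    mu2.-integrable setT (EFin \o (fun p => h p * lcprod (bump_at a e) (bump_at b e) p)).
  move=> /andP[al ar] /andP[bl br]; apply: integrable_box.
    move=> p; apply: cvgM; first exact: ch.
    by apply: continuous_lcprod; exact/smooth1_continuous/smooth1_bump_at.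
  move=> p; rewrite mulf_eq0 negb_or => /andP[_].
  rewrite mulf_eq0 negb_or => /andP[].
  move=> /(bump_at_neq0 e0)/andP[as1 as2] /(bump_at_neq0 e0)/andP[bs1 bs2].
  apply: Bp; apply/andP; split.
  - exact: le_lt_trans al _.
  - by apply: lt_le_trans as2 _; rewrite lerD2r.
  - exact: le_lt_trans bl _.
  - by apply: lt_le_trans bs2 _; rewrite lerD2r.
have i11 := int a1 b1; have i12 := int a1 b2; have i21 := int a2 b1; have i22 := int a2 b2.
rewrite !lexx a12 b12 in i11 i12 i21 i22.
have {}i11 := i11 isT isT; have {}i12 := i12 isT isT.
have {}i21 := i21 isT isT; have {}i22 := i22 isT isT.
rewrite (@eq_Rintegral _ _ _ mu2 _ (fun p => (- 4) *
   ((h p * lcprod (bump_at a1 e) (bump_at b1 e) p +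
     h p * lcprod (bump_at a2 e) (bump_at b2 e) p) -
    (h p * lcprod (bump_at a1 e) (bump_at b2 e) p +
     h p * lcprod (bump_at a2 e) (bump_at b1 e) p)))); last first.
  by move=> p _; rewrite /lcprod /dplateau; ring.
rewrite (Rintegral_second_difference _ i11 i22 i12 i21).
rewrite -/(K a1 b1) -/(K a1 b2) -/(K a2 b1) -/(K a2 b2).
by rewrite mulNr oppr_ge0 pmulr_rle0// subr_le0.
Unshelve. all: by end_near. Qed.

End NullRectangle.

(** * Time increments of functions with a weak time derivative *)

Section TimeRegularity.
Context {R : realType}.
Implicit Types (f g : R -> R) (h k : R * R -> R).

Local Notation mu := (@lebesgue_measure R).
Local Notation mu2 := (mu \x mu)%E.

Lemma integrable_segment f a b : continuous f -> mu.-integrable `[a, b] (EFin \o f).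
Proof.
move=> cf; apply: continuous_compact_integrable; first exact: segment_compact.
exact: continuous_subspaceT.
Qed.

Lemma patch_segment f a b : (forall x, f x != 0 -> a <= x <= b) -> f \_ `[a, b] = f.
Proof.
move=> fab; apply/funext => x; rewrite patchE; case: ifPn => // /negP xI.
apply/esym/eqP/negPn/negP => /fab xab; apply: xI.
by rewrite inE/= in_itv/=.
Qed.

Lemma integral_patch_segment f a b : (forall x, f x != 0 -> a <= x <= b) ->
  (\int[mu]_x (f x)%:E = \int[mu]_(x in `[a, b]) (f x)%:E)%E.
Proof.
move=> fab; rewrite [RHS]integral_mkcond; apply: eq_integral => x _.
by rewrite -{1}(patch_segment fab) !patchE; case: ifP.
Qed.

Lemma integrable_patch_segment f a b : continuous f ->
  (forall x, f x != 0 -> a <= x <= b) -> mu.-integrable setT (EFin \o f).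
Proof.
move=> cf fab; rewrite -(patch_segment fab).
have := (@integrable_mkcond _ _ _ mu `[a, b]%classic (EFin \o f) (measurable_itv _)).1.
by rewrite restrict_EFin; apply; exact: integrable_segment.
Qed.

Lemma EFin_Rintegral d (T : measurableType d) (nu : {measure set T -> \bar R}) D (f : T -> R) :
  measurable D -> nu.-integrable D (EFin \o f) ->
  (\int[nu]_(x in D) (f x)%:E = (\int[nu]_(x in D) f x)%:E)%E.
Proof. by move=> mD fi; rewrite fineK//; exact: integrable_fin_num. Qed.

Lemma Rintegral_prod f g a b c d : continuous f -> continuous g ->
  (forall x, f x != 0 -> a <= x <= b) -> (forall x, g x != 0 -> c <= x <= d) ->
  \int[mu2]_p (f p.1 * g p.2) = (\int[mu]_(x in `[a, b]) f x) * (\int[mu]_(x in `[c, d]) g x).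
Proof.
move=> cf cg fab gcd.
have int : mu2.-integrable setT (EFin \o (fun p => f p.1 * g p.2)).
  apply: (@integrable_box R a b c d) => [p|p].
    apply: cvgM.
      by apply: (@continuous_comp _ _ _ fst f); [exact: continuous_fst2|exact: cf].
    by apply: (@continuous_comp _ _ _ snd g); [exact: continuous_snd2|exact: cg].
  rewrite mulf_eq0 negb_or => /andP[/fab ? /gcd ?].
  by split; rewrite /= in_itv.
rewrite {1}/Rintegral -(integral12_prod_meas1 int)/=.
transitivity (fine (\int[mu]_x ((\int[mu]_(y in `[c, d]) g y) * f x)%:E)).
  congr fine; apply: eq_integral => x _; rewrite /fubini_F/=.
  rewrite EFinM -EFin_Rintegral//; last exact: integrable_segment.
  rewrite -integral_patch_segment// muleC -integralZl//.
  exact: (integrable_patch_segment cg gcd).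
rewrite (@integral_patch_segment _ a b); last first.
  by move=> x; rewrite mulf_eq0 negb_or => /andP[_]; exact: fab.
by rewrite -/(Rintegral _ _ _) RintegralZl// 1?mulrC//; exact: integrable_segment.
Qed.

(** Tube-lemma argument: compactness of the segment, as a near-covering property, makes the
    neighbourhood of s uniform in x. *)
Lemma continuous_uniform_segment h (a b s del : R) : continuous h -> 0 < del ->
  \forall t \near s, forall x, a <= x <= b -> `|h (x, t) - h (x, s)| <= del.
Proof.
move=> ch del0.
have := @segment_compact R a b => /compact_near_coveringP.
move=> /(_ R (nbhs s) (fun t x => `|h (x, t) - h (x, s)| <= del) _) H.
suff /H : forall x, `[a, b]%classic x ->
    \forall x' \near x & t \near s, `|h (x', t) - h (x', s)| <= del.
  by apply: filterS => t Ht x xab; apply: Ht; rewrite /= in_itv.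
move=> x _.
have d2 : 0 < del / 2 by rewrite divr_gt0.
have /cvgrPdist_le/(_ _ d2) := ch (x, s).
case=> -[X T] /= [nX nT] XT; exists (X, T) => //= -[x' t] [/= Xx Tt].
have h1 := XT (x', t) (conj Xx Tt); have h2 := XT (x', s) (conj Xx (nbhs_singleton nT)).
rewrite (_ : h (x', t) - h (x', s) = (h (x, s) - h (x', s)) - (h (x, s) - h (x', t))); last first.
  by ring.
by rewrite [leRHS]splitr; apply: le_trans (ler_normB _ _) (lerD h2 h1).
Qed.

Lemma continuous_section h t : continuous h -> continuous (fun x => h (x, t)).
Proof.
move=> ch x; apply: (@continuous_comp _ _ _ (fun x : R => (x, t)) h); last exact: ch.
exact: (@cvg_pair _ _ _ (nbhs x) (nbhs x) (nbhs t) _ _ _ id (cst t) cvg_id (cvg_cst t)).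
Qed.

(** Uniformity in s is what permits s0 = 0: there the mollifier is placed at s = e, so that its
    support remains in t > 0. *)
Lemma time_average h f (a b s0 del : R) : continuous h -> continuous f -> 0 < del ->
  (forall x, f x != 0 -> a <= x <= b) ->
  \forall e \near 0^'+, forall s, `|s - s0| <= e ->
    `|\int[mu2]_p (h p * (f p.1 * bump_at s e p.2)) -
      \int[mu]_(x in `[a, b]) (h (x, s0) * f x)|
    <= del * \int[mu]_(x in `[a, b]) `|f x|.
Proof.
move=> ch cf del0 fab.
have /nbhs_ballP[r r0 hr] := @continuous_uniform_segment h a b s0 del ch del0.
near=> e.
have e0 : 0 < e by near: e; exact: nbhs_right_gt.
(* The offset of s and the width of the bump are each at most e, so times stay within 2 e < r of
   s0. *)
have er : e <= r / 3 by near: e; apply: nbhs_right_le; rewrite divr_gt0.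
move=> s ss0.
have cb : continuous (bump_at s e : R -> R).
  exact/smooth1_continuous/smooth1_bump_at.
have bs x : bump_at s e x != 0 -> s <= x <= s + e.
  by move=> /(bump_at_neq0 e0)/andP[? ?]; rewrite !ltW.
have Ib : \int[mu]_(x in `[s, s + e]) bump_at s e x = 1.
  by rewrite /Rintegral integral_bump_at.
pose h0 x := h (x, s0).
have ch0 : continuous h0 by exact: continuous_section.
have ch0f : continuous (fun x => h0 x * f x) by move=> x; apply: cvgM; [exact: ch0|exact: cf].
have h0fab x : h0 x * f x != 0 -> a <= x <= b.
  by rewrite mulf_eq0 negb_or => /andP[_ /fab].
have cnf : continuous (fun x => `|f x|).
  by move=> x; apply: (@continuous_comp _ _ _ f Num.norm); [exact: cf|exact: norm_continuous].
have nfab x : `|f x| != 0 -> a <= x <= b by rewrite normr_eq0; exact: fab.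
have cfst g : continuous g -> continuous (fun p : R * R => g p.1).
  by move=> cg p; apply: (@continuous_comp _ _ _ fst g); [exact: continuous_fst2|exact: cg].
have csnd g : continuous g -> continuous (fun p : R * R => g p.2).
  by move=> cg p; apply: (@continuous_comp _ _ _ snd g); [exact: continuous_snd2|exact: cg].
have int k : continuous k ->
    mu2.-integrable setT (EFin \o (fun p => k p * (f p.1 * bump_at s e p.2))).
  move=> ck; apply: (@integrable_box R a b s (s + e)) => [p|p].
    by apply: cvgM; [exact: ck|apply: cvgM; [exact: cfst|exact: csnd]].
  rewrite mulf_eq0 negb_or => /andP[_]; rewrite mulf_eq0 negb_or => /andP[/fab ? /bs ?].
  by split; rewrite /= in_itv.
have -> : \int[mu]_(x in `[a, b]) (h (x, s0) * f x) =
    \int[mu2]_p (h0 p.1 * (f p.1 * bump_at s e p.2)).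
  rewrite -[LHS]mulr1 -Ib -(Rintegral_prod ch0f cb h0fab bs).
  by apply: eq_Rintegral => p _; rewrite mulrA.
rewrite -RintegralB//; [|exact: int|exact/int/cfst].
have ik : mu2.-integrable setT
    (EFin \o (fun p => (h p - h0 p.1) * (f p.1 * bump_at s e p.2))).
  by apply: int => p; apply: cvgB; [exact: ch|exact: (cfst _ ch0)].
rewrite (@eq_Rintegral _ _ _ mu2 _
  (fun p => (h p - h0 p.1) * (f p.1 * bump_at s e p.2))); last by move=> p _; rewrite mulrBl.
apply: le_trans (le_normr_Rintegral measurableT ik) _.
have cK : continuous (fun p : R * R => `|f p.1| * bump_at s e p.2).
  by move=> p; apply: cvgM; [exact: (cfst _ cnf)|exact: csnd].
have iK : mu2.-integrable setT (EFin \o (fun p => `|f p.1| * bump_at s e p.2)).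
  apply: (@integrable_box R a b s (s + e)) => // p.
  by rewrite mulf_eq0 negb_or => /andP[/nfab ? /bs ?]; split; rewrite /= in_itv.
rewrite -[X in del * X]mulr1 -Ib -(Rintegral_prod cnf cb nfab bs) -RintegralZl//.
apply: le_Rintegral => //.
- exact: integrable_norm ik.
- exact: (integrableZl measurableT del iK).
move=> p _; rewrite normrM normrM (ger0_norm (bump_at_ge0 _ e0 _)).
have [->|bp] := eqVneq (bump_at s e p.2) 0; first by rewrite !mulr0.
have [->|fp] := eqVneq (f p.1) 0; first by rewrite normr0 mul0r !mulr0.
apply: ler_wpM2r; first by rewrite mulr_ge0// bump_at_ge0.
rewrite [p in h p]surjective_pairing; apply: hr; last exact: fab.
move: bp => /bs/andP[sp ps]; move: ss0; rewrite ler_norml => /andP[l1 l2].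
by rewrite /ball/= ltr_norml; clear -e0 er r0 sp ps l1 l2; apply/andP; split; lra.
Unshelve. all: by end_near. Qed.

End TimeRegularity.

(** * Bounding the pairing with the weak time derivative *)

Section WeakTimeDerivative.
Context {R : realType}.
Implicit Types (f g : R -> R) (h k : R * R -> R).

Local Notation mu := (@lebesgue_measure R).
Local Notation mu2 := (mu \x mu)%E.
Local Notation RxR := (measurableTypeR R * measurableTypeR R)%type.

Lemma norm_Rintegral_le d (T : measurableType d) (nu : {measure set T -> \bar R})
    (f : T -> R) (M : R) :
  measurable_fun setT f -> (\int[nu]_x `|f x|%:E <= M%:E)%E ->
  `|\int[nu]_x f x| <= M.
Proof.
move=> mf fM.
have fi : nu.-integrable setT (EFin \o f).
  apply/integrableP; split; first exact/measurable_EFinP.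
  exact: le_lt_trans fM (ltry _).
apply: le_trans (le_normr_Rintegral measurableT fi) _.
rewrite -lee_fin -EFin_Rintegral//.
exact: integrable_norm fi.
Qed.

Lemma measurable_halfplane : measurable (halfplane : set RxR).
Proof.
have -> : (halfplane : set (R * R)) = setT `*` `]0, +oo[%classic.
  by apply/seteqP; split=> p; rewrite /halfplane/= in_itv/= andbT; [|case].
exact: measurableX.
Qed.

(** For z = 1 and z = -1, the difference of the two sides is the square (l/2) (x - z y / l)^2. *)
Lemma mul_le_weighted (l x y : R) : 0 < l ->
  `|x * y| <= l / 2 * x ^+ 2 + l^-1 / 2 * y ^+ 2.
Proof.
move=> l0.
have H (z : R) : z ^+ 2 = 1 -> z * (x * y) <= l / 2 * x ^+ 2 + l^-1 / 2 * y ^+ 2.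
  move=> z1; rewrite -subr_ge0.
  have -> : l / 2 * x ^+ 2 + l^-1 / 2 * y ^+ 2 - z * (x * y) =
      (l / 2) * (x - z * (l^-1 * y)) ^+ 2.
    rewrite sqrrB exprMn z1 mul1r; field; exact: lt0r_neq0.
  by rewrite mulr_ge0 ?sqr_ge0// divr_ge0// ltW.
rewrite ler_norml -lerNl -mulN1r H ?sqrrN ?expr1n//=.
by rewrite -[leLHS]mul1r H// expr1n.
Qed.

Section PairingBound.
Variables (ut : R * R -> R) (f g : R -> R) (a b c d T C l : R).
Hypotheses (mut : measurable_fun (halfplane : set RxR) ut) (C0 : 0 <= C)
  (utC : {ae mu, forall t : R, 0 < t < T ->
            (\int[mu]_(x in `[a, b]) (ut (x, t) ^+ 2)%:E <= C%:E)%E})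
  (cf : continuous f) (cg : continuous g)
  (fab : forall x, f x != 0 -> a <= x <= b)
  (gcd : forall x, g x != 0 -> c <= x <= d)
  (g01 : forall x, 0 <= g x <= 1)
  (c0 : 0 < c) (cd : c <= d) (dT : d < T) (l0 : 0 < l).

Let If2 := \int[mu]_(x in `[a, b]) (f x ^+ 2).
Let N := l / 2 * C + l^-1 / 2 * If2.
(** Measurability of [ut] is known on the half-plane only; extension by zero makes Tonelli
    applicable on the plane. *)
Let v : R * R -> R := ut \_ halfplane.
Let k : R * R -> R := fun p => `|v p * (f p.1 * g p.2)|.

Let mv : measurable_fun setT (v : RxR -> R).
Proof. exact: (measurable_restrictT ut measurable_halfplane).1 mut. Qed.

Let cfg : continuous (fun p : R * R => f p.1 * g p.2).
Proof.
move=> p; apply: cvgM.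
  by apply: (@continuous_comp _ _ _ fst f); [exact: continuous_fst2|exact: cf].
by apply: (@continuous_comp _ _ _ snd g); [exact: continuous_snd2|exact: cg].
Qed.

Let mvfg : measurable_fun setT (fun p : RxR => v p * (f p.1 * g p.2)).
Proof. by apply: measurable_funM => //; exact: continuous2_measurable. Qed.

Let mk : measurable_fun setT (EFin \o k : RxR -> \bar R).
Proof. by apply/measurable_EFinP; exact: measurableT_comp. Qed.

Let cf2 : continuous (fun x => f x ^+ 2).
Proof. by move=> x; apply: cvgM; exact: cf. Qed.

Let If2_ge0 : 0 <= If2.
Proof. by apply: Rintegral_ge0 => x _; rewrite sqr_ge0. Qed.

Let N_ge0 : 0 <= N.
Proof. by rewrite addr_ge0// mulr_ge0// divr_ge0// ?invr_ge0 ltW. Qed.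

(** The L^2 bound enters as an implication because it holds for almost every t only. If g t is
    nonzero then t lies in [c, d], inside (0, T), and the weighted inequality integrates to N. *)
Let slice (t : R) :
  (0 < t < T -> (\int[mu]_(x in `[a, b]) (ut (x, t) ^+ 2)%:E <= C%:E)%E) ->
  (\int[mu]_x (k (x, t))%:E <= (g t * N)%:E)%E.
Proof.
have g0 : 0 <= g t by case/andP: (g01 t).
have [gt0 _|gtn0 Ht] := eqVneq (g t) 0.
  rewrite gt0 mul0r integral0_eq// => x _.
  by rewrite /k/= gt0 !mulr0 normr0.
have /andP[ct td] := gcd gtn0.
have t0 : 0 < t by exact: lt_le_trans ct.
have {}Ht : (\int[mu]_(x in `[a, b]) (v (x, t) ^+ 2)%:E <= C%:E)%E.
  have := Ht; rewrite t0 (le_lt_trans td dT) => /(_ isT).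
  apply: le_trans; rewrite le_eqVlt; apply/orP; left; apply/eqP.
  apply: eq_integral => x _; rewrite /v patchE ifT//.
  by rewrite inE /halfplane.
have mvt : measurable_fun setT (fun x => v (x, t)).
  exact: (@measurable_fun_pair1 _ _ _ _ _ _ (v : RxR -> R) t mv).
rewrite (@integral_patch_segment _ _ a b); last first.
  move=> x; rewrite /k/= normr_eq0 !mulf_eq0 !negb_or => /and3P[_ fx _].
  exact: fab.
pose A1 x := (g t * (l / 2)) * v (x, t) ^+ 2.
pose A2 x := (g t * (l^-1 / 2)) * f x ^+ 2.
have c1 : 0 <= g t * (l / 2) by rewrite mulr_ge0// divr_ge0// ltW.
have c2 : 0 <= g t * (l^-1 / 2) by rewrite mulr_ge0// divr_ge0// invr_ge0 ltW.
have mv2 : measurable_fun `[a, b] (fun x => v (x, t) ^+ 2).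
  by apply: measurable_funTS; exact: measurable_funX.
have mf2 : measurable_fun `[a, b] (fun x => f x ^+ 2).
  by apply: measurable_funTS; exact: continuous_measurable_fun.
apply: (@le_trans _ _ (\int[mu]_(x in `[a, b]) ((A1 x)%:E + (A2 x)%:E))%E).
  apply: ge0_le_integral => //.
  - by move=> x xab; rewrite lee_fin normr_ge0.
  - apply: measurable_funTS; exact: (@measurable_fun_pair1 _ _ _ _ _ _ _ t mk).
  - by apply/measurable_EFinP; apply: measurable_funD; apply: measurable_funM.
  - move=> x _; rewrite -EFinD lee_fin /k/= mulrA normrM (ger0_norm g0) mulrC.
    apply: le_trans (ler_wpM2l g0 (mul_le_weighted (v (x, t)) (f x) l0)) _.
    by rewrite /A1 /A2 mulrDr !mulrA.
rewrite ge0_integralD//; last 4 first.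
- by move=> x _; rewrite lee_fin mulr_ge0// sqr_ge0.
- by apply/measurable_EFinP; apply: measurable_funM.
- by move=> x _; rewrite lee_fin mulr_ge0// sqr_ge0.
- by apply/measurable_EFinP; apply: measurable_funM.
under eq_integral do rewrite EFinM.
rewrite ge0_integralZl//; last 2 first.
- exact/measurable_EFinP.
- by move=> x _; rewrite lee_fin sqr_ge0.
under [X in (_ + X)%E]eq_integral do rewrite EFinM.
rewrite ge0_integralZl//; last 2 first.
- exact/measurable_EFinP.
- by move=> x _; rewrite lee_fin sqr_ge0.
rewrite [X in (_ + _ * X)%E]EFin_Rintegral//; last exact: integrable_segment.
rewrite -/If2 /N mulrDr EFinD !mulrA -EFinM; apply: leeD => //.
rewrite [leRHS]EFinM; apply: lee_wpmul2l => //.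
by rewrite lee_fin -mulrA.
Qed.

(* AM-GM with weight l replaces Cauchy-Schwarz; weak_time_increment takes for l
   the length of the time interval. *)
Lemma pairing_le : `|pairing ut (fun p => f p.1 * g p.2)| <= (d - c) * N.
Proof.
have -> : pairing ut (fun p => f p.1 * g p.2) = \int[mu2]_p (v p * (f p.1 * g p.2)).
  rewrite /pairing Rintegral_mkcond; apply: eq_Rintegral => p _.
  by rewrite /v !patchE; case: ifP => _ //; rewrite mul0r.
apply: norm_Rintegral_le => //.
(* The x-integral is taken first, since the bound C is available on time slices. *)
rewrite [leLHS](fubini_tonelli2 (m1 := mu) (m2 := mu) (EFin \o k))//; last first.
  by move=> p; rewrite lee_fin normr_ge0.
have gN t : g t * N != 0 -> c <= t <= d.
  by rewrite mulf_eq0 negb_or => /andP[/gcd].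
have cgN : continuous (fun t => g t * N) by move=> t; apply: cvgMl; exact: cg.
apply: (@le_trans _ _ (\int[mu]_t (g t * N)%:E)%E).
  apply: ae_ge0_le_integral => //.
  - by move=> t _; apply: integral_ge0 => x _; rewrite lee_fin normr_ge0.
  - by apply: measurable_fun_fubini_tonelli_G => // p; rewrite lee_fin normr_ge0.
  - by move=> t _; rewrite lee_fin mulr_ge0//; case/andP: (g01 t).
  - by apply/measurable_EFinP; exact: continuous_measurable_fun.
  - have := @filterS _ (almost_everywhere mu) (ae_filter_ringOfSetsType mu) _ _ _ utC.
    by apply => t Ht _; exact: slice.
rewrite (@integral_patch_segment _ _ c d)//.
apply: (@le_trans _ _ (\int[mu]_(t in `[c, d]) (cst N%:E t))%E).
  apply: ge0_le_integral => //.
  - by move=> t _; rewrite lee_fin mulr_ge0//; case/andP: (g01 t).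
  - by apply: measurable_funTS; apply/measurable_EFinP; exact: continuous_measurable_fun.
  - by move=> t _; rewrite lee_fin ler_piMl//; case/andP: (g01 t).
rewrite integral_cst//= lebesgue_measure_itv/= lte_fin.
case: ifPn => [_|]; first by rewrite -EFinD -EFinM mulrC.
by rewrite -leNgt mule0 lee_fin => dc; rewrite mulr_ge0// subr_ge0.
Qed.

End PairingBound.
End WeakTimeDerivative.

(** * Increments from t = 0 and smooth approximation *)

Section InitialIncrement.
Context {R : realType}.
Implicit Types (f g : R -> R) (h k : R * R -> R).

Local Notation mu := (@lebesgue_measure R).
Local Notation mu2 := (mu \x mu)%E.
Local Notation RxR := (measurableTypeR R * measurableTypeR R)%type.

Lemma smooth2_prod f g : smooth1 f -> smooth1 g -> smooth2 (fun p => f p.1 * g p.2).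
Proof.
move=> sf sg.
have -> : (fun p : R * R => f p.1 * g p.2) =
    (fun p => f (1 * p.1 + 0 * p.2 + 0) * g (0 * p.1 + 1 * p.2 + 0)).
  by apply/funext => p; rewrite !mul1r !mul0r !addr0 add0r.
by apply: smooth2M; exact: smooth2_affine.
Qed.

Lemma is_derive_prod2 (v p : R * R) f f' g g' :
  (forall x : R, is_derive x 1 f (f' x)) -> (forall x : R, is_derive x 1 g (g' x)) ->
  is_derive p v (fun q : R * R => f q.1 * g q.2)
    (v.1 * (f' p.1 * g p.2) + v.2 * (f p.1 * g' p.2)).
Proof.
move=> df dg.
have F := is_derive_affine2 v (df (1 * p.1 + 0 * p.2 + 0)).
have G := is_derive_affine2 v (dg (0 * p.1 + 1 * p.2 + 0)).
apply: (is_derive_congr (is_deriveM F G)) => [q|].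
  by rewrite fctE !mul1r !mul0r !addr0 add0r.
by rewrite /GRing.scale/= !mul1r !mul0r !addr0 !add0r; ring.
Qed.

Lemma derive_t_prod f g (f' g' : R -> R) :
  (forall x : R, is_derive x 1 f (f' x)) -> (forall x : R, is_derive x 1 g (g' x)) ->
  'D_e_t (fun p : R * R => f p.1 * g p.2) = fun p => f p.1 * g' p.2.
Proof.
move=> df dg; apply/funext => p; have [_ ->] := is_derive_prod2 e_t p df dg.
by rewrite /= mul0r mul1r add0r.
Qed.

(** Test the weak derivative with f(x) psi(t), psi a mollified indicator of [0, h]: psi' yields the
    values at both ends, and [pairing_le] with weight h bounds the other side. *)
Lemma weak_time_increment (U ut : R * R -> R) f (a b T C h : R) :
  continuous U -> weak_partial e_t U ut ->
  measurable_fun (halfplane : set RxR) ut -> 0 <= C ->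
  {ae mu, forall t : R, 0 < t < T ->
     (\int[mu]_(x in `[a, b]) (ut (x, t) ^+ 2)%:E <= C%:E)%E} ->
  0 < h < T -> smooth1 f -> (forall x, f x != 0 -> a <= x <= b) ->
  \int[mu]_(x in `[a, b]) (U (x, h) * f x) - \int[mu]_(x in `[a, b]) (U (x, 0) * f x) <=
  2^-1 * (h ^+ 2 * C + \int[mu]_(x in `[a, b]) (f x ^+ 2)).
Proof.
move=> cU wU mut C0 utC /andP[h0 hT] sf fab.
have cf := smooth1_continuous sf; have [f' _ df] := smooth1_derive sf.
apply/ler_addgt0Pr => del del0.
pose M := \int[mu]_(x in `[a, b]) `|f x|.
have M0 : 0 <= M by apply: Rintegral_ge0 => x _; exact: normr_ge0.
(* Two mollification errors eta M must add up to at most del; the summand 1 covers M = 0. *)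
pose eta := del / (2 * (M + 1)).
have M1 : 0 < 2 * (M + 1) by rewrite mulr_gt0// ltr_wpDl.
have eta0 : 0 < eta by rewrite divr_gt0.
have etaM : eta * M + eta * M <= del.
  have M1' : 0 < M + 1 by rewrite ltr_wpDl.
  have -> : eta * M + eta * M = del * (M / (M + 1)).
    by rewrite /eta; field; exact: lt0r_neq0.
  by rewrite ler_piMr ?(ltW del0)// ler_pdivrMr// mul1r lerDl.
pose K e s := \int[mu2]_p (U p * (f p.1 * bump_at s e p.2)).
near (0 : R)^'+ => e.
have e0 : 0 < e by near: e; exact: nbhs_right_gt.
have eh : e <= h by near: e; exact: nbhs_right_le.
have eT : e < T - h by near: e; apply: nbhs_right_lt; rewrite subr_gt0.
have Kh : `|K e h - \int[mu]_(x in `[a, b]) (U (x, h) * f x)| <= eta * M.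
  have : forall s, `|s - h| <= e -> `|K e s - \int[mu]_(x in `[a, b]) (U (x, h) * f x)| <= eta * M.
    by near: e; exact: time_average.
  by apply; rewrite subrr normr0 ltW.
have K0 : `|K e e - \int[mu]_(x in `[a, b]) (U (x, 0) * f x)| <= eta * M.
  have : forall s, `|s - 0| <= e -> `|K e s - \int[mu]_(x in `[a, b]) (U (x, 0) * f x)| <= eta * M.
    by near: e; exact: time_average.
  by apply; rewrite subr0 gtr0_norm.
(* Starting at e keeps the support in t > 0, and [e, h + e] still has length exactly h. *)
pose psi := plateau e h e.
have spsi : smooth1 psi := smooth1_plateau e h e.
have test : test_function halfplane (fun p => f p.1 * psi p.2).
  apply: (@test_function_box _ a b e (h + e)) => //; first exact: smooth2_prod.
  move=> p; rewrite mulf_eq0 negb_or => /andP[/fab ? /(plateau_neq0 eh e0)/andP[? ?]].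
  by split; rewrite /= in_itv//=; rewrite !ltW.
have := wU _ test; rewrite (derive_t_prod df (is_derive_plateau e h e)).
rewrite (@pairing_box _ a b e (h + e))//; last first.
  move=> p; rewrite mulf_eq0 negb_or => /andP[/fab ? /(dplateau_neq0 eh e0)/andP[? ?]].
  by split; rewrite /= in_itv//=; rewrite !ltW.
have int s : e <= s -> mu2.-integrable setT (EFin \o (fun p => U p * (f p.1 * bump_at s e p.2))).
  move=> es; apply: (@integrable_box R a b s (s + e)) => [p|p].
    apply: cvgM; first exact: cU.
    apply: cvgM.
      by apply: (@continuous_comp _ _ _ fst f); [exact: continuous_fst2|exact: cf].
    apply: (@continuous_comp _ _ _ snd (bump_at s e)); first exact: continuous_snd2.
    exact/smooth1_continuous/smooth1_bump_at.
  rewrite mulf_eq0 negb_or => /andP[_]; rewrite mulf_eq0 negb_or.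
  move=> /andP[/fab ? /(bump_at_neq0 e0)/andP[? ?]].
  by split; rewrite /= in_itv//=; rewrite !ltW.
rewrite (@eq_Rintegral _ _ _ mu2 _ (fun p => U p * (f p.1 * bump_at e e p.2) -
  U p * (f p.1 * bump_at h e p.2))); last by move=> p _; rewrite /dplateau !mulrBr.
rewrite RintegralB//; [|exact: int|exact: int].
rewrite -/(K e e) -/(K e h) => Keq.
have psi01 x : 0 <= psi x <= 1 by rewrite plateau_ge0// plateau_le1.
have psisupp x : psi x != 0 -> e <= x <= h + e.
  by move=> /(plateau_neq0 eh e0)/andP[? ?]; rewrite !ltW.
have ehe : e <= h + e by rewrite lerDr ltW.
have heT : h + e < T by rewrite -ltrBrDl.
have := @pairing_le R ut f psi a b e (h + e) T C h mut C0 utC cf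
  (smooth1_continuous spsi) fab psisupp psi01 e0 ehe heT h0.
rewrite addrK => /(le_trans (ler_norm _)).
rewrite -[pairing ut _]opprK -Keq opprB.
have -> : h * (h / 2 * C + h^-1 / 2 * \int[mu]_(x in `[a, b]) f x ^+ 2) =
    2^-1 * (h ^+ 2 * C + \int[mu]_(x in `[a, b]) f x ^+ 2).
  by field; exact: lt0r_neq0.
move: Kh K0 etaM; rewrite !ler_norml => /andP[k1 _] /andP[_ k2].
move: k1 k2.
move: (K e h) (K e e) (eta * M) => x1 x2 x3.
set y1 := \int[mu]_(x in _) (U (x, h) * _); set y2 := \int[mu]_(x in _) (U (x, 0) * _).
set y3 := 2^-1 * _.
clearbody y1 y2 y3; clear => *; lra.
Unshelve. all: by end_near. Qed.

(** Samples f at a fine grid and glues the values with a partition of unity made of plateaus. A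
    finite sum, unlike a convolution, visibly stays in the class [smooth1]. *)
Lemma smooth1_approx f (a b del : R) : continuous f -> a < b -> 0 < del ->
  (forall x, f x != 0 -> a <= x <= b) ->
  exists g, [/\ smooth1 g, forall x, g x != 0 -> a - 1 <= x <= b + 1 &
                forall x, `|g x - f x| <= del].
Proof.
move=> cf ab del0 fab.
have cft : continuous (fun p : R * R => f (p.1 + p.2)).
  move=> p; apply: (@continuous_comp _ _ _ (fun p : R * R => p.1 + p.2) f); last exact: cf.
  by apply: cvgD; [exact: continuous_fst2|exact: continuous_snd2].
(* Uniform continuity of f, read off from the function (x, t) |-> f (x + t) near t = 0. *)
have /nbhs_ballP[r r0 fr] := @continuous_uniform_segment R _ a b 0 del cft del0.
have [n en] : exists n : nat, (b - a) / n.+1%:R < Num.min r 1.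
  have m0 : 0 < Num.min r 1 by rewrite lt_min r0 ltr01.
  have q0 : 0 < Num.min r 1 / (b - a) by rewrite divr_gt0// subr_gt0.
  have := @near_infty_natSinv_lt R (PosNum q0).
  case=> n _ /(_ n (leqnn n)) /= Hn; exists n.
  by move: Hn; rewrite ltr_pdivlMr ?subr_gt0// mulrC.
set e := (b - a) / n.+1%:R in en.
have e0 : 0 < e by rewrite divr_gt0// subr_gt0.
move: en; rewrite lt_min => /andP[er e1].
pose X (j : nat) := a + j%:R * e.
have XS j : X j.+1 - e = X j by rewrite /X -natr1 mulrDl mul1r addrA addrK.
have Xn : X n.+1 = b by rewrite /X /e; field.
have Xab (j : nat) : (j < n.+2)%N -> a <= X j <= b.
  move=> jn; rewrite /X lerDl mulr_ge0//=; last by rewrite ltW.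
  by rewrite -[leRHS]Xn /X lerD2l ler_wpM2r// ?ler_nat// ltW.
pose B j x := plateau (X j - e) (X j) e x.
have Xe j : X j - e <= X j by rewrite gerBl ltW.
have B0 j x : 0 <= B j x by exact: plateau_ge0.
have BX j x : B j x != 0 -> X j - e < x < X j + e by exact: plateau_neq0.
pose g x := \sum_(0 <= j < n.+2) f (X j) * B j x.
pose S x := \sum_(0 <= j < n.+2) B j x.
(* Each plateau is the difference of two consecutive steps, so the sum telescopes and equals 1 on
   [a, b]. *)
have SE x : S x = sstep_at (a - e) e x - sstep_at b e x.
  rewrite /S (telescope_sumr_eq (fun j => - sstep_at (X j - e) e x))//.
    by rewrite opprK addrC XS Xn /X mul0r addr0.
  by move=> j _; rewrite /B /plateau XS opprK addrC.
have S1 x : S x <= 1 by rewrite SE lerBlDr ler_wpDr ?sstep_at_ge0 ?sstep_at_le1.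
have Sx1 x : a <= x <= b -> S x = 1.
  move=> /andP[ax xb]; rewrite SE sstep_at_ge ?sstep_at_le ?subr0// subrK//.
exists g; split.
- have : forall m, smooth1 (fun x => \sum_(0 <= j < m) f (X j) * B j x).
    elim=> [|m IH].
      rewrite (_ : (fun x => _) = cst 0); first exact: smooth1_cst.
      by apply/funext => x; rewrite big_geq.
    rewrite (_ : (fun x => _) =
      (fun x => \sum_(0 <= j < m) f (X j) * B j x + f (X m) * B m x)).
      apply: smooth1D => //; apply: smooth1M; first exact: (smooth1_cst (f (X m))).
      exact: smooth1_plateau.
    by apply/funext => x; rewrite big_nat_recr.
  exact.
- move=> x; apply: contra_neqT => xab; rewrite /g big_nat_cond big1// => j.
  rewrite andbT => /andP[_ jn].
  have [->|/BX/andP[? ?]] := eqVneq (B j x) 0; first by rewrite mulr0.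
  have /andP[? ?] := Xab _ jn.
  by exfalso; move/negP: xab; apply; apply/andP; split; lra.
- move=> x.
  have -> : g x - f x = \sum_(0 <= j < n.+2) (f (X j) - f x) * B j x - f x * (1 - S x).
    under eq_bigr do rewrite mulrBl.
    rewrite sumrB -mulr_sumr -/(g x) -/(S x); ring.
  (* Where the partition does not sum to 1, f vanishes. *)
  have -> : f x * (1 - S x) = 0.
    by have [->|/fab/Sx1 ->] := eqVneq (f x) 0; rewrite ?mul0r// subrr mulr0.
  rewrite subr0; apply: le_trans (ler_norm_sum _ _ _) _.
  apply: (@le_trans _ _ (del * S x)); last by rewrite ler_piMr// ltW.
  rewrite /S mulr_sumr; apply: ler_sum_nat => j /andP[_ jn].
  rewrite normrM (ger0_norm (B0 _ _)).
  have [->|/BX/andP[x1 x2]] := eqVneq (B j x) 0; first by rewrite !mulr0.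
  apply: ler_wpM2r => //; rewrite distrC.
  have xr : ball 0 r (x - X j).
    by rewrite /ball/= sub0r normrN ltr_norml; clear -x1 x2 er; apply/andP; split; lra.
  by have := fr _ xr _ (Xab _ jn); rewrite addr0 [X j + _]addrC subrK.
Qed.

End InitialIncrement.

(** * L^2 bound on initial increments and convergence in L^1 *)

Section SegmentIntegrals.
Context {R : realType}.
Implicit Types (f g : R -> R) (h k : R * R -> R).

Local Notation mu := (@lebesgue_measure R).
Local Notation RxR := (measurableTypeR R * measurableTypeR R)%type.

Lemma le_Rintegral_segment f g (a b : R) : continuous f -> continuous g ->
  (forall x, a <= x <= b -> f x <= g x) ->
  \int[mu]_(x in `[a, b]) f x <= \int[mu]_(x in `[a, b]) g x.
Proof.
move=> cf cg fg; apply: le_Rintegral => //.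
- exact: (integrable_segment a b cf).
- exact: (integrable_segment a b cg).
Qed.

Lemma Rintegral_segmentD f g (a b : R) : continuous f -> continuous g ->
  \int[mu]_(x in `[a, b]) (f x + g x) =
  \int[mu]_(x in `[a, b]) f x + \int[mu]_(x in `[a, b]) g x.
Proof. by move=> cf cg; rewrite RintegralD//;
  [exact: (integrable_segment a b cf)|exact: (integrable_segment a b cg)]. Qed.

Lemma Rintegral_segmentZ (c : R) f (a b : R) : continuous f ->
  \int[mu]_(x in `[a, b]) (c * f x) = c * \int[mu]_(x in `[a, b]) f x.
Proof. by move=> cf; rewrite RintegralZl//; exact: (integrable_segment a b cf). Qed.

Lemma Rintegral_subsegment f (a b a' b' : R) : continuous f -> (forall x, 0 <= f x) ->
  a' <= a -> b <= b' ->
  \int[mu]_(x in `[a, b]) f x <= \int[mu]_(x in `[a', b']) f x.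
Proof.
move=> cf f0 aa bb; rewrite -lee_fin -!EFin_Rintegral//;
  [|exact: (integrable_segment _ _ cf)|exact: (integrable_segment _ _ cf)].
apply: ge0_subset_integral => //.
- by apply: measurable_funTS; apply/measurable_EFinP; exact: continuous_measurable_fun.
- by move=> x _; rewrite lee_fin.
- by move=> x /=; rewrite !in_itv/= => /andP[? ?]; apply/andP; split; lra.
Qed.

Lemma continuousMr f g : continuous f -> continuous g -> continuous (fun x => f x * g x).
Proof. by move=> cf cg x; apply: cvgM; [exact: cf|exact: cg]. Qed.

Lemma continuousDr f g : continuous f -> continuous g -> continuous (fun x => f x + g x).
Proof. by move=> cf cg x; apply: cvgD; [exact: cf|exact: cg]. Qed.

Lemma continuousBr f g : continuous f -> continuous g -> continuous (fun x => f x - g x).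
Proof. by move=> cf cg x; apply: cvgB; [exact: cf|exact: cg]. Qed.

Lemma continuous_normr f : continuous f -> continuous (fun x => `|f x|).
Proof.
by move=> cf x; apply: (@continuous_comp _ _ _ f Num.norm); [exact: cf|exact: norm_continuous].
Qed.

Lemma continuous_sqr f : continuous f -> continuous (fun x => f x ^+ 2).
Proof. by move=> cf; exact: continuousMr. Qed.

(* Duality: weak_time_increment with f close to the increment itself. *)
Lemma initial_increment_L2 (U ut : R * R -> R) (A B T C h : R) :
  continuous U -> weak_partial e_t U ut ->
  measurable_fun (halfplane : set RxR) ut -> 0 <= C -> A <= B ->
  {ae mu, forall t : R, 0 < t < T ->
     (\int[mu]_(x in `[(A - 2)%R, (B + 2)%R]) (ut (x, t) ^+ 2)%:E <= C%:E)%E} ->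
  0 < h < T ->
  \int[mu]_(x in `[A, B]) ((U (x, h) - U (x, 0)) ^+ 2) <= h ^+ 2 * C.
Proof.
move=> cU wU mut C0 AB utC hT.
set a := A - 2; set b := B + 2.
pose f x := U (x, h) - U (x, 0).
(* The cutoff costs a margin 1 on each side and [smooth1_approx] another 1, whence the margin 2 in
   the bound on [ut]. *)
pose chi : R -> R := plateau (A - 1) B 1.
pose f1 x := f x * chi x.
have AB1 : A - 1 <= B by lra.
have chi0 x : 0 <= chi x by exact: plateau_ge0.
have chi1 x : chi x <= 1 by exact: plateau_le1.
have chiAB x : A <= x <= B -> chi x = 1.
  by move=> /andP[Ax xB]; rewrite /chi /plateau sstep_at_ge ?sstep_at_le ?subr0// subrK.
have cf : continuous f by apply: continuousBr; exact: continuous_section.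
have cchi : continuous chi by exact/smooth1_continuous/smooth1_plateau.
have cf1 : continuous f1 by exact: continuousMr.
have f1supp x : f1 x != 0 -> A - 1 <= x <= B + 1.
  rewrite mulf_eq0 negb_or => /andP[_ /(plateau_neq0 AB1 ltr01)/andP[? ?]].
  by rewrite !ltW.
pose I (g : R -> R) := \int[mu]_(x in `[a, b]) g x.
have I0 g : (forall x, 0 <= g x) -> 0 <= I g by move=> g0; exact: Rintegral_ge0.
suff fI : I (fun x => f1 x ^+ 2) <= h ^+ 2 * C.
  apply: le_trans fI.
  rewrite (@eq_Rintegral _ _ _ mu _ (fun x => f1 x ^+ 2)); last first.
    by move=> x; rewrite inE/= in_itv/= => xAB; rewrite /f1 chiAB// mulr1.
  apply: Rintegral_subsegment; first exact: continuous_sqr.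
  - by move=> x; exact: sqr_ge0.
  - by rewrite /a; lra.
  - by rewrite /b; lra.
(* Collects the errors of replacing f1 by th, in the product with f and in the square; the second
   uses del <= 1 to get |th + f1| <= 2 |f1| + 1. *)
pose Q := I (fun x => `|f x|) + I (fun x => 2 * `|f1 x| + 1).
have Q0 : 0 <= Q.
  by apply: addr_ge0; apply: I0 => x //; rewrite addr_ge0// mulr_ge0.
apply/ler_addgt0Pr => eps eps0.
pose del := Num.min 1 (eps / (2 * (Q + 1))).
have Q1 : 0 < Q + 1 by rewrite ltr_wpDl.
have del0 : 0 < del by rewrite lt_min ltr01 divr_gt0// mulr_gt0.
have del1 : del <= 1 by rewrite ge_min lexx.
have delQ : 2 * (del * Q) <= eps.
  apply: (@le_trans _ _ (2 * (eps / (2 * (Q + 1)) * Q))).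
    by rewrite ler_pM2l// ler_wpM2r// ge_min lexx orbT.
  have -> : 2 * (eps / (2 * (Q + 1)) * Q) = eps * (Q / (Q + 1)).
    by field; exact: lt0r_neq0.
  by rewrite ler_piMr ?(ltW eps0)// ler_pdivrMr// mul1r lerDl.
have AB2 : A - 1 < B + 1 by lra.
have [th [sth thsupp thf]] := smooth1_approx cf1 AB2 del0 f1supp.
have cth := smooth1_continuous sth.
have thab x : th x != 0 -> a <= x <= b.
  by move=> /thsupp/andP[? ?]; rewrite /a /b; apply/andP; split; lra.
have inc := weak_time_increment cU wU mut C0 utC hT sth thab.
have E1 : I (fun x => U (x, h) * th x) - I (fun x => U (x, 0) * th x) =
    I (fun x => f x * th x).
  rewrite /I -RintegralB//; last 2 first.
  - by apply: integrable_segment; apply: continuousMr => //; exact: continuous_section.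
  - by apply: integrable_segment; apply: continuousMr => //; exact: continuous_section.
  by apply: eq_Rintegral => x _; rewrite /f mulrBl.
move: inc; rewrite -/(I _) -/(I _) -/(I _) E1 => inc.
have E2 : I (fun x => f1 x ^+ 2) <= I (fun x => f x * th x) + del * I (fun x => `|f x|).
  rewrite /I -Rintegral_segmentZ; last exact: continuous_normr.
  rewrite -Rintegral_segmentD; last 2 first.
  - exact: continuousMr.
  - by apply: continuousMr; [exact: cst_continuous|exact: continuous_normr].
  apply: le_Rintegral_segment; first exact: continuous_sqr.
    apply: continuousDr; first exact: continuousMr.
    by apply: continuousMr; [exact: cst_continuous|exact: continuous_normr].
  move=> x _; apply: (@le_trans _ _ (f x * f1 x)).
    rewrite /f1 exprMn mulrA -expr2 ler_wpM2l ?sqr_ge0//.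
    by rewrite expr2 ler_piMl.
  rewrite -lerBlDl -mulrBr; apply: le_trans (ler_norm _) _.
  by rewrite normrM mulrC ler_wpM2r// distrC.
have E3 : I (fun x => th x ^+ 2) <=
    I (fun x => f1 x ^+ 2) + del * I (fun x => 2 * `|f1 x| + 1).
  have cN : continuous (fun x => 2 * `|f1 x| + 1).
    apply: continuousDr; last exact: cst_continuous.
    by apply: continuousMr; [exact: cst_continuous|exact: continuous_normr].
  have cD : continuous (fun x => del * (2 * `|f1 x| + 1)).
    by apply: continuousMr => //; exact: cst_continuous.
  rewrite /I -Rintegral_segmentZ// -Rintegral_segmentD//; last exact: continuous_sqr.
  apply: le_Rintegral_segment; first exact: continuous_sqr.
    by apply: continuousDr => //; exact: continuous_sqr.
  move=> x _; have := thf x; rewrite -lerBlDl subr_sqr => Hx.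
  apply: le_trans (ler_norm _) _; rewrite normrM; apply: ler_pM => //.
  have -> : th x + f1 x = (th x - f1 x) + 2 * f1 x by ring.
  apply: le_trans (ler_normD _ _) _.
  by rewrite normrM [`|2|]ger0_norm// addrC lerD2l (le_trans Hx).
have y5_0 : 0 <= del * I (fun x => 2 * `|f1 x| + 1).
  by rewrite mulr_ge0 ?(ltW del0)// I0// => x; rewrite addr_ge0// mulr_ge0.
(* The integral of f1^2 returns on the right with coefficient 1/2 and is absorbed, leaving h^2 C
   plus at most 2 del Q. *)
move: inc E2 E3 delQ y5_0; rewrite /Q.
move: (I (fun x => f x * th x)) (I (fun x => th x ^+ 2)) (I (fun x => f1 x ^+ 2))
  (I (fun x => `|f x|)) (I (fun x => 2 * `|f1 x| + 1)) (h ^+ 2 * C) => x1 x2 x3 x4 x5 x6.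
rewrite !mulrDr; move: (del * x4) (del * x5) => y4 y5; clear.
lra.
Qed.

(** Truncation at height M: the truncated functions converge by dominated convergence, and where |f|
    > M one has |f| <= f^2 / M. *)
Lemma L1_cvg0 (f_ : (R -> R)^nat) (a b C : R) :
  (forall n, continuous (f_ n)) ->
  {ae mu, forall x : R, f_ n x @[n --> \oo] --> 0} ->
  (forall n, \int[mu]_(x in `[a, b]) (f_ n x ^+ 2) <= C) ->
  \int[mu]_(x in `[a, b]) `|f_ n x| @[n --> \oo] --> 0.
Proof.
move=> cf f0 fC.
have C0 : 0 <= C by apply: le_trans (fC 0%N); apply: Rintegral_ge0 => x _; exact: sqr_ge0.
apply/cvgr0Pnorm_le => eps eps0.
(* Makes C / M at most eps/2; the summand 1 keeps M positive when C = 0. *)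
pose M := (2 * C + 1) / eps.
have M0 : 0 < M by rewrite divr_gt0// ltr_wpDl// mulr_ge0.
pose m n x := Num.min `|f_ n x| M.
have cm n : continuous (m n).
  have cn := continuous_normr (cf n).
  have cM : continuous (fun _ : R => M) by move=> x; exact: cvg_cst.
  have -> : m n = fun x => (`|f_ n x| + M - `| `|f_ n x| - M |) * 2^-1.
    by apply/funext => x; rewrite /m minr_absE.
  apply: continuousMr; last by move=> x; exact: cvg_cst.
  apply: continuousBr; first exact: continuousDr.
  by apply: continuous_normr; exact: continuousBr.
have m0 n x : 0 <= m n x by rewrite le_min normr_ge0 ltW.
have mI n : mu.-integrable `[a, b] (EFin \o m n) by exact: integrable_segment.
have := @dominated_convergence _ _ _ mu `[a, b]%classic (measurable_itv _)
  (fun n => EFin \o m n) (cst 0%E) (cst M%:E).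
case.
- by move=> n; apply: measurable_int; exact: mI.
- exact: measurable_cst.
- apply: (@filterS _ (almost_everywhere mu) (ae_filter_ringOfSetsType mu) _ _ _ f0).
  move=> x fx _; apply: cvg_EFin => //; first by near=> n.
  apply: (@squeeze_cvgr _ _ _ _ (cst 0) (fun n => `|f_ n x|)).
  + by near=> n; rewrite m0/= /m ge_min lexx.
  + exact: cvg_cst.
  + by rewrite -[X in _ --> X](@normr0 _ R); exact: cvg_norm.
- exact: (@integrable_segment R (cst M) a b (@cst_continuous _ _ _)).
- apply: aeW => x n _ /=; rewrite lee_fin ger0_norm//.
  by rewrite ge_min lexx orbT.
move=> _ _; rewrite integral0 => /fine_cvgP[_] /cvgr0Pnorm_le H.
have e2 : 0 < eps / 2 by rewrite divr_gt0.
move: (H _ e2); apply: filterS => n /= mn.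
rewrite ger0_norm; last by apply: Rintegral_ge0.
rewrite -/(Rintegral _ _ _) in mn.
apply: (@le_trans _ _ (\int[mu]_(x in `[a, b]) m n x +
    M^-1 * \int[mu]_(x in `[a, b]) (f_ n x ^+ 2))).
  have c2 : continuous (fun x => M^-1 * f_ n x ^+ 2).
    by apply: continuousMr; [exact: cst_continuous|exact: continuous_sqr].
  rewrite -Rintegral_segmentZ; last exact: continuous_sqr.
  rewrite -Rintegral_segmentD//.
  apply: le_Rintegral_segment; first exact: continuous_normr.
    exact: continuousDr.
  move=> x _; rewrite /m; case: (leP `|f_ n x| M) => [_|Mf].
    by rewrite lerDl mulr_ge0 ?sqr_ge0// invr_ge0 ltW.
  apply: ler_wpDl; first exact: ltW.
  by rewrite -real_normK ?num_real// expr2 mulrA ler_peMl// ler_pdivlMl// mulr1 ltW.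
rewrite [leRHS]splitr; apply: lerD; first exact: le_trans (ler_norm _) mn.
rewrite ler_pdivrMl//; apply: le_trans (fC n) _.
rewrite /M; have -> : (2 * C + 1) / eps * (eps / 2) = C + 2^-1.
  by field; exact: lt0r_neq0.
by rewrite lerDl invr_ge0.
Unshelve. all: by end_near. Qed.

End SegmentIntegrals.

(** * Superadditivity and growth *)

Section Superadditive.
Context {R : realType}.
Implicit Types (f g : R -> R) (h k : R * R -> R).

Local Notation mu := (@lebesgue_measure R).

Lemma Rintegral_translate f (a b c : R) : continuous f -> a <= b ->
  \int[mu]_(x in `[a, b]) f (x + c) = \int[mu]_(x in `[(a + c)%R, (b + c)%R]) f x.
Proof.
move=> cf ab.
have dF (x : R) : is_derive x 1 (fun x => x + c) 1.
  by apply: (is_derive_congr (is_derive_affine 1 c x)) => // y; rewrite mul1r.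
have d : derive1 (fun x => x + c) = cst 1.
  by apply/funext => x; rewrite derive1E; have [_ ->] := dF x.
have cF : continuous (fun x : R => x + c) := is_derive_continuous dF.
rewrite /Rintegral; congr fine.
rewrite [RHS](@integration_by_substitution_increasing _ (fun x => x + c) f)//.
- by apply: eq_integral => x _; rewrite d/= mulr1.
- by move=> x y _ _; rewrite ltrD2r.
- by rewrite d => x _; exact: cvg_cst.
- by rewrite d; exact: is_cvg_cst.
- by rewrite d; exact: is_cvg_cst.
- split; first by move=> x _; have [] := dF x.
    by apply: cvg_at_right_filter; exact: cF.
  by apply: cvg_at_left_filter; exact: cF.
- exact: continuous_subspaceT.
Qed.

(* Halving the interval n times bounds the integral of F(., t) over [a, b] from
   below by -t times the integral of |F(., t/2^n)| / (t/2^n). *)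
Lemma superadditive_ge0 (F : R -> R -> R) (t : R) : 0 < t ->
  (forall s, continuous (F^~ s)) ->
  (forall y s, 0 <= s -> F (y - s) s + F (y + s) s <= F y (2 * s)) ->
  (forall a b, \int[mu]_(y in `[a, b]) `|F y (t / 2 ^+ n) / (t / 2 ^+ n)|
     @[n --> \oo] --> 0) ->
  forall y, 0 <= F y t.
Proof.
move=> t0 cF supF limF.
have cnF s : continuous (fun y => `|F y s|) by exact: continuous_normr.
have cFD s c : continuous (fun y => F (y + c) s).
  move=> y; apply: (@continuous_comp _ _ _ (fun y => y + c) (F^~ s)); last exact: cF.
  by apply: cvgD; [exact: cvg_id|exact: cvg_cst].
have iter n : forall a b s, a <= b -> 0 <= s ->
    - (2 ^+ n * \int[mu]_(y in `[(a - 2 ^+ n * s)%R, (b + 2 ^+ n * s)%R]) `|F y s|) <=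
    \int[mu]_(y in `[a, b]) F y (2 ^+ n * s).
  elim: n => [|n IH] a b s ab s0.
    rewrite expr0 !mul1r; apply: (@le_trans _ _ (- \int[mu]_(y in `[a, b]) `|F y s|)).
      rewrite lerN2; apply: Rintegral_subsegment => //; first by rewrite gerBl.
      by rewrite lerDl.
    rewrite -mulN1r -Rintegral_segmentZ//; apply: le_Rintegral_segment => //.
      by apply: continuousMr => // y; exact: cvg_cst.
    by move=> x _; rewrite mulN1r lerNl -normrN ler_norm.
  (* The translates of [a, b] by S and by -S, widened by S, both lie in [a - 2 S, b + 2 S], so both
     halves are bounded through the same J. *)
  set S := 2 ^+ n * s.
  have S0 : 0 <= S by rewrite mulr_ge0// exprn_ge0.
  have -> : 2 ^+ n.+1 * s = 2 * S by rewrite exprS mulrA.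
  set J := \int[mu]_(y in `[(a - 2 * S)%R, (b + 2 * S)%R]) `|F y s|.
  apply: (@le_trans _ _ (\int[mu]_(y in `[a, b]) (F (y - S) S + F (y + S) S))); last first.
    apply: le_Rintegral_segment => //; first by apply: continuousDr; exact: cFD.
    by move=> y _; exact: supF.
  rewrite Rintegral_segmentD//.
  rewrite (@Rintegral_translate (F^~ S))// (@Rintegral_translate (F^~ S))//.
  have H1 : - (2 ^+ n * J) <= \int[mu]_(y in `[(a - S)%R, (b - S)%R]) F y S.
    apply: le_trans (IH _ _ s _ s0); last by rewrite lerD2r.
    rewrite lerN2 ler_wpM2l ?exprn_ge0//; apply: Rintegral_subsegment => //.
      by rewrite -/S; lra.
    by rewrite -/S; lra.
  have H2 : - (2 ^+ n * J) <= \int[mu]_(y in `[(a + S)%R, (b + S)%R]) F y S.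
    apply: le_trans (IH _ _ s _ s0); last by rewrite lerD2r.
    rewrite lerN2 ler_wpM2l ?exprn_ge0//; apply: Rintegral_subsegment => //.
      by rewrite -/S; lra.
    by rewrite -/S; lra.
  apply: le_trans (lerD H1 H2).
  by rewrite exprS -mulrA -opprD lerN2 mulr_natl mulr2n.
have int_ge0 a b : a <= b -> 0 <= \int[mu]_(y in `[a, b]) F y t.
  move=> ab; apply/ler_addgt0Pr => eps eps0.
  have e1 : 0 < eps / t by rewrite divr_gt0.
  have /cvgr0Pnorm_le/(_ _ e1)[n _ /(_ n (leqnn n)) Hn] := limF (a - t) (b + t).
  have p0 : (0 : R) < 2 ^+ n by rewrite exprn_gt0.
  have := iter n a b (t / 2 ^+ n) ab (ltW (divr_gt0 t0 p0)).
  (* Hence the widened interval is [a - t, b + t] for every n, and one limit suffices. *)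
  have -> : 2 ^+ n * (t / 2 ^+ n) = t by rewrite mulrC divfK// gt_eqF.
  move: Hn; rewrite ger0_norm; last by apply: Rintegral_ge0 => y _.
  rewrite (@eq_Rintegral _ _ _ mu _ (fun y => (2 ^+ n / t) * `|F y (t / 2 ^+ n)|)); last first.
    move=> y _; rewrite normrM [`|_^-1|]gtr0_norm ?invr_gt0 ?divr_gt0//.
    by rewrite invf_div mulrC.
  rewrite Rintegral_segmentZ//.
  move: (\int[mu]_(y in _) _) => J HJ.
  rewrite -subr_ge0 opprK addrC => HI.
  rewrite -lerBlDr sub0r; apply: (@le_trans _ _ (- (2 ^+ n * J))).
    rewrite lerN2 -(ler_pM2r (_ : 0 < t^-1)) ?invr_gt0//.
    by rewrite mulrAC.
  by rewrite -subr_ge0 opprK addrC.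
(* A negative value at y0 would, by continuity, keep F below half of it on a short segment and make
   that integral negative. *)
move=> y0; rewrite leNgt; apply/negP => Fneg.
have d0 : 0 < - F y0 t / 2 by rewrite divr_gt0// oppr_gt0.
have /cvgrPdist_le/(_ _ d0)/nbhs_ballP[r /= r0 Hr] := cF t y0.
have r2 : 0 < r / 2 by rewrite divr_gt0.
have := int_ge0 y0 (y0 + r / 2); rewrite lerDl (ltW r2) => /(_ isT).
apply/negP; rewrite -ltNge.
apply: (@le_lt_trans _ _ (\int[mu]_(y in `[y0, (y0 + r / 2)%R]) (F y0 t / 2))).
  apply: le_Rintegral_segment => //; first by move=> y; exact: cvg_cst.
  move=> y /andP[y1 y2].
  have yb : ball y0 r y.
    by rewrite /ball/= ltr_norml; clear -y1 y2 r0; apply/andP; split; lra.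
  by move: (Hr _ yb) => /=; rewrite ler_norml => /andP[+ _]; rewrite -/(F y0 t) -/(F y t); move: (F y0 t) (F y t); clear => z1 z2; lra.
rewrite Rintegral_cst//= lebesgue_measure_itv/= lte_fin ltrDl r2/=.
rewrite addrAC subrr add0r pmulr_llt0// pmulr_llt0// invr_gt0//.
Qed.

End Superadditive.

(** * The free wave and elementary bounds on the sine *)

Section FreeWave.
Context {R : realType}.
Implicit Types (f g : R -> R).

Lemma free_wave_sin_sin (c : R) :
  free_wave (fun=> c) (fun x => sin x) (fun p : R * R => c + sin p.1 * sin p.2).
Proof.
have ds (x : R) : is_derive x 1 sin (cos x) by exact: is_derive_sin.
have dc (x : R) : is_derive x 1 cos (- sin x) by exact: is_derive_cos.
have dw (v p : R * R) : is_derive p v (fun p : R * R => c + sin p.1 * sin p.2)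
    (v.1 * (cos p.1 * sin p.2) + v.2 * (sin p.1 * cos p.2)).
  have := is_deriveD (is_derive_cst c p v) (is_derive_prod2 v p ds ds).
  by move=> H; apply: (is_derive_congr H) => //; rewrite add0r.
have Dx : 'D_e_x (fun p : R * R => c + sin p.1 * sin p.2) =
    fun p => cos p.1 * sin p.2.
  by apply/funext => p; have [_ ->] := dw e_x p; rewrite /= mul1r mul0r addr0.
have Dt : 'D_e_t (fun p : R * R => c + sin p.1 * sin p.2) =
    fun p => sin p.1 * cos p.2.
  by apply/funext => p; have [_ ->] := dw e_t p; rewrite /= mul1r mul0r add0r.
split.
- apply/smooth2_smooth/smooth2D; first exact: smooth2_cst.
  by apply: smooth2_prod; exact: smooth1_sin.
- move=> p _; rewrite /box Dx Dt.
  have [_ ->] := is_derive_prod2 e_t p ds dc.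
  have [_ ->] := is_derive_prod2 e_x p dc ds.
  by rewrite /=; ring.
- by move=> x; rewrite /= sin0 mulr0 addr0.
- move=> x; have [_ dwx] := dw e_t (x, 0).
  by apply: etrans dwx _; rewrite /= mul0r mul1r add0r cos0 mulr1.
Qed.

Lemma sin_le_id (h : R) : 0 <= h -> `|sin h| <= h.
Proof.
move=> h0.
(* Both signs at once: x + c sin x has derivative 1 + c cos x >= 0. *)
have H (c : R) : `|c| = 1 -> 0 <= h + c * sin h.
  move=> c1.
  have d (x : R) : is_derive x 1 (fun x => x + c * sin x) (1 + c * cos x).
    exact: (is_derive_congr (is_deriveD (is_derive_id x 1) (is_deriveZ c (is_derive_sin x)))).
  rewrite [leLHS](_ : 0 = 0 + c * sin 0 :> R); last by rewrite sin0 mulr0 addr0.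
  apply: (@ger0_derive1_le_cc R (fun x => x + c * sin x) 0 h).
  - by move=> x _; have [] := d x.
  - move=> x _; rewrite derive1E; have [_ ->] := d x.
    rewrite -lerBlDl sub0r; have : `|c * cos x| <= 1 by rewrite normrM c1 mul1r cos_max.
    by rewrite ler_norml => /andP[].
  - exact/continuous_subspaceT/(is_derive_continuous d).
  - by rewrite in_itv/= lexx.
  - by rewrite in_itv/= lexx h0.
  - exact: h0.
have := H 1 (normr1 _); have := H (-1) (normrN1 _).
by rewrite ler_norml mul1r mulN1r => ? ?; apply/andP; split; lra.
Qed.

Lemma sin_div_cvg1 : (sin h : R) / h @[h --> 0^'+] --> (1 : R).
Proof.
apply: cvg_dnbhs_at_right.
have [ds D] := is_derive_sin (0 : R).
have := ds; rewrite /derivable => /cvg_ex[l Hl].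
have l1 : l = 1 by rewrite -(cos0 R) -D; apply/esym; exact: cvg_lim Hl.
rewrite -l1; apply: cvg_trans Hl; apply: near_eq_cvg.
by near=> h; rewrite /= addr0 sin0 subr0 /GRing.scale/= mulr1 mulrC.
Unshelve. all: by end_near. Qed.

End FreeWave.

Lemma sqrB_le2 {R : realDomainType} (x y : R) :
  y ^+ 2 <= 1 -> (x - y) ^+ 2 <= 2 * x ^+ 2 + 2.
Proof. by move=> y1; have := sqr_ge0 (x + y); nra. Qed.

(** * The obstacle solution compared with the free wave *)

Section Obstacle.
Context {R : realType}.
Variables (u ux ut : R * R -> R).

Local Notation mu := (@lebesgue_measure R).
Local Notation RxR := (measurableTypeR R * measurableTypeR R)%type.

Hypothesis u_class : energy_class u ux ut.
Hypothesis u_obstacle : zero_obstacle u.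
Hypothesis u_init : initial_data (fun=> 1 / 2) (fun x => sin x) u.

(* u is only continuous on t >= 0; U extends it continuously to the plane. *)
Let U (p : R * R) : R := u (p.1, (p.2 + `|p.2|) / 2).

Let cvg_point {T : Type} (G : set_system T) {FG : Filter G} (f g : T -> R) (x y : R) :
  f z @[z --> G] --> x -> g z @[z --> G] --> y -> (f z, g z) @[z --> G] --> (x, y).
Proof. exact: cvg_pair. Qed.

Let clamp_ge0 (x : R) : 0 <= (x + `|x|) / 2.
Proof. by have := ler_norm (- x); rewrite normrN; lra. Qed.

Let UE p : 0 <= p.2 -> U p = u p.
Proof.
move=> p0; rewrite /U ger0_norm//; have -> : (p.2 + p.2) / 2 = p.2 by field.
by rewrite -surjective_pairing.
Qed.

Let U_ge0 p : 0 <= U p.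
Proof.
by case: u_obstacle => u0 _ _; apply: u0; exact: clamp_ge0.
Qed.

(** The clamp takes values in the closed half-plane, so continuity of u within it becomes plain
    continuity after composition. *)
Let cU : continuous U.
Proof.
case: u_class => cu _ _ _ _ p.
pose c (q : R * R) : R * R := (q.1, (q.2 + `|q.2|) / 2).
have cH q : halfplane_closed (c q) by exact: clamp_ge0.
have cc : c q @[q --> p] --> c p.
  apply: cvg_point; first exact: continuous_fst2.
  apply: cvgM; last exact: cvg_cst.
  apply: cvgD; first exact: continuous_snd2.
  by apply: cvg_norm; exact: continuous_snd2.
have := (subspace_continuousP _ _).1 cu _ (cH p).
move=> uc; apply: (@cvg_comp _ _ _ c u _ (within halfplane_closed (nbhs (c p)))) uc.
move=> B; rewrite /within/= => /cc H.
have {}H : \forall q \near p, halfplane_closed (c q) -> B (c q) by exact: H.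
by near=> q; have : halfplane_closed (c q) -> B (c q); [near: q|apply; exact: cH].
Unshelve. all: by end_near.
Qed.

Let pairingU k : pairing U k = pairing u k.
Proof.
apply: eq_Rintegral => p; rewrite inE => p0.
by rewrite UE// ltW.
Qed.

Let U_box : box_ge0 U.
Proof. by case: u_obstacle => _ ub _ phi tphi phi0; rewrite pairingU; exact: ub. Qed.

Let U_weak : weak_partial e_t U ut.
Proof. by case: u_class => _ _ _ uw _ phi tphi; rewrite pairingU; exact: uw. Qed.

Let ut_meas : measurable_fun (halfplane : set RxR) ut.
Proof. by case: u_class => _ []. Qed.

Let measurable_slice (v : R * R -> R) (t a b : R) :
  measurable_fun (halfplane : set RxR) v -> 0 < t ->
  measurable_fun `[a, b] (fun x => v (x, t)).
Proof.
move=> mv t0; apply: measurable_funTS.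
have := (measurable_restrictT v measurable_halfplane).1 mv => mV.
have := @measurable_fun_pair1 _ _ _ _ _ _ _ t mV.
congr measurable_fun; apply/funext => x; rewrite patchE ifT//.
by rewrite inE /halfplane.
Qed.

Let ut_bound (a b T : R) : 0 < T -> exists2 C : R, 0 <= C &
  {ae mu, forall t : R, 0 < t < T ->
     (\int[mu]_(x in `[a, b]) (ut (x, t) ^+ 2)%:E <= C%:E)%E}.
Proof.
move=> T0; case: u_class => _ [mux mut] _ _ /(_ _ _ (@segment_compact R a b) T0)[C HC].
exists (Num.max 0 C); first by rewrite le_max lexx.
apply: (@filterS _ (almost_everywhere mu) (ae_filter_ringOfSetsType mu) _ _ _ HC).
move=> t Ht t0T; have {}Ht := Ht t0T; have /andP[t0 _] := t0T.
have Cmax : (C%:E <= (Num.max 0 C)%:E)%E by rewrite lee_fin le_max lexx orbT.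
apply: le_trans (le_trans Ht Cmax).
have mu_t : measurable_fun `[a, b] (fun x => u (x, t)).
  apply: measurable_funTS.
  have -> : (fun x => u (x, t)) = (fun x => U (x, t)).
    by apply/funext => x; rewrite UE//= ltW.
  by apply: continuous_measurable_fun; exact: continuous_section.
apply: ge0_le_integral => //.
- by move=> x xab; rewrite lee_fin sqr_ge0.
- by apply/measurable_EFinP; apply: measurable_funX; exact: measurable_slice.
- apply/measurable_EFinP; apply: measurable_funD.
    by apply: measurable_funD; apply: measurable_funX; apply: measurableT_comp => //;
      exact: measurable_slice.
  by apply: measurable_funX; apply: measurableT_comp => //; exact: measurable_slice.
- move=> x _; rewrite lee_fin -[leLHS]real_normK ?num_real//.
  by rewrite lerDr addr_ge0// exprn_ge0.
Qed.

(* F is u - w, with w the free wave, and D its value at triangle apexes. *)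
Let F (y s : R) : R := U (y, s) - (1 / 2 + sin y * sin s).

Let cF s : continuous (F^~ s).
Proof.
apply: continuousBr; first exact: continuous_section.
apply: continuousDr; first by move=> y; exact: cvg_cst.
apply: continuousMr; last by move=> y; exact: cvg_cst.
exact/smooth1_continuous/smooth1_sin.
Qed.

Let U0 x : U (x, 0) = 1 / 2.
Proof. by case: u_init => u0 _; rewrite UE. Qed.

Let F0 y : F y 0 = 0.
Proof. by rewrite /F U0 sin0 mulr0 addr0 subrr. Qed.

Let D (b a : R) : R := F ((a + b) / 2) ((a - b) / 2).

(** Product-to-sum formula: w splits into a function of b plus a function of a, so it cancels in the
    rectangle inequality. *)
Let DE b a : D b a = apex U b a - (1 / 2 + (cos b - cos a) / 2).
Proof.
rewrite /D /F /apex; congr (_ - (_ + _)).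
have : cos ((a + b) / 2 - (a - b) / 2) - cos ((a + b) / 2 + (a - b) / 2) =
    2 * (sin ((a + b) / 2) * sin ((a - b) / 2)) by rewrite cosB cosD; ring.
have -> : (a + b) / 2 - (a - b) / 2 = b by field.
have -> : (a + b) / 2 + (a - b) / 2 = a by field.
by move=> ->; rewrite [RHS]mulrC mulKf.
Qed.

(** [null_rectangle] needs the bottom corner strictly above t = 0. Shifting c and a by e, where they
    serve as x + t, lifts it to height e/2; then e tends to 0. *)
Let apex_rectangle (b c a : R) : b <= c <= a ->
  apex U b c + apex U c a <= apex U b a + apex U c c.
Proof.
move=> /andP[bc ca].
have capex (y z : R) : apex U y (z + e) @[e --> 0^'+] --> apex U y z.
  apply: cvg_at_right_filter; apply: (@cvg_comp _ _ _
    (fun e : R => ((z + e + y) / 2, (z + e - y) / 2)) U _ (nbhs ((z + y) / 2, (z - y) / 2)));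
    last exact: cU.
  have ce : z + e @[e --> (0 : R)] --> z.
    by rewrite -[X in _ --> X]addr0; apply: cvgD; [exact: cvg_cst|exact: cvg_id].
  apply: cvg_point; (apply: cvgM; last exact: cvg_cst).
    by apply: cvgD => //; exact: cvg_cst.
  by apply: cvgB => //; exact: cvg_cst.
have cvg1 : apex U b (c + e) + apex U c (a + e) @[e --> (0 : R)^'+] -->
    apex U b c + apex U c a by apply: cvgD; exact: capex.
have cvg2 : apex U b (a + e) + apex U c (c + e) @[e --> (0 : R)^'+] -->
    apex U b a + apex U c c by apply: cvgD; exact: capex.
apply: (@ler_cvg_to R (0^'+) _ R _ _ _ _ cvg1 cvg2).
near=> e; apply: null_rectangle => //; first by rewrite lerD2r.
by rewrite ltrDl; near: e; exact: nbhs_right_gt.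
Unshelve. all: by end_near. Qed.

(** The bottom corner carries the initial value 1/2, and the cosines telescope. *)
Let D_superadditive (b c a : R) : b <= c <= a -> D b c + D c a <= D b a.
Proof.
move=> bca; have := apex_rectangle bca; rewrite !DE.
have -> : apex U c c = 1 / 2.
  rewrite /apex (_ : (c - c) / 2 = 0); first exact: U0.
  by rewrite subrr mul0r.
by move: (apex U b c) (apex U c a) (apex U b a) => x1 x2 x3; lra.
Qed.

Let F_superadditive (y s : R) : 0 <= s -> F (y - s) s + F (y + s) s <= F y (2 * s).
Proof.
move=> s0; have := @D_superadditive (y - 2 * s) y (y + 2 * s).
rewrite /D.
have -> : (y + (y - 2 * s)) / 2 = y - s by field.
have -> : (y - (y - 2 * s)) / 2 = s by field.
have -> : (y + 2 * s + y) / 2 = y + s by field.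
have -> : (y + 2 * s - y) / 2 = s by field.
have -> : (y + 2 * s + (y - 2 * s)) / 2 = y by field.
have -> : (y + 2 * s - (y - 2 * s)) / 2 = 2 * s by field.
by apply; apply/andP; split; lra.
Qed.

Let F_limit (t a b : R) : 0 < t ->
  \int[mu]_(y in `[a, b]) `|F y (t / 2 ^+ n) / (t / 2 ^+ n)| @[n --> \oo] --> 0.
Proof.
move=> t0; have [ba|ab] := ltP b a.
  under eq_fun do rewrite set_itv_ge ?bnd_simp -?ltNge// Rintegral_set0.
  exact: cvg_cst.
pose h (n : nat) : R := t / 2 ^+ n.
have h0 n : 0 < h n by rewrite divr_gt0// exprn_gt0.
have ht n : h n <= t by rewrite ler_pdivrMr ?exprn_gt0// ler_peMr ?(ltW t0)// exprn_ege1// ler1n.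
have hcvg : h n @[n --> \oo] --> (0 : R).
  have -> : h = fun n => t * 2^-1 ^+ n by apply/funext => n; rewrite /h exprVn.
  rewrite -[X in _ --> X](mulr0 t); apply: cvgMr; apply: cvg_expr.
  by rewrite ger0_norm ?invr_ge0// invf_lt1// ltr1n.
have T0 : 0 < t + 1 by rewrite addr_gt0.
have [C C0 utC] := @ut_bound (a - 2) (b + 2) (t + 1) T0.
(* The quotient is X - Y with X the quotient of U and Y that of the sine product; (X - Y)^2 <= 2 X^2
   + 2, and X^2 has integral at most C. *)
apply: (@L1_cvg0 R (fun n y => F y (h n) / h n) a b (2 * C + 2 * (b - a))).
- by move=> n; apply: continuousMr => // y; exact: cvg_cst.
- case: u_init => _ ae1.
  apply: (@filterS _ (almost_everywhere mu) (ae_filter_ringOfSetsType mu) _ _ _ ae1).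
  move=> x Hx.
  have H1 := (cvg_at_rightP _ _ _).1 Hx h (conj h0 hcvg).
  have H2 := (cvg_at_rightP _ _ _).1 (@sin_div_cvg1 R) h (conj h0 hcvg).
  have H3 : sin x * (sin (h n) / h n) @[n --> \oo] --> sin x.
    by rewrite -[X in _ --> X]mulr1; apply: cvgMr; exact: H2.
  have {H1 H2}H3 := cvgB H1 H3; rewrite subrr in H3.
  suff -> : (fun n => F x (h n) / h n) =
      (fun n => (u (x, h n) - u (x, 0)) / h n - sin x * (sin (h n) / h n)) by exact: H3.
  apply/funext => n; rewrite /F -[u (x, 0)]UE// -[u (x, h n)]UE; last by rewrite ltW/=.
  by rewrite U0; field; exact: lt0r_neq0.
- move=> n; set hn := h n; have hn0 : 0 < hn := h0 n.
  have cinc : continuous (fun y => (U (y, hn) - U (y, 0)) ^+ 2).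
    by apply: continuous_sqr; apply: continuousBr; exact: continuous_section.
  apply: (@le_trans _ _ (\int[mu]_(y in `[a, b])
      ((2 / hn ^+ 2) * (U (y, hn) - U (y, 0)) ^+ 2 + 2))).
    apply: le_Rintegral_segment.
    + by apply: continuous_sqr; apply: continuousMr => // y; exact: cvg_cst.
    + apply: continuousDr; last by move=> y; exact: cvg_cst.
      by apply: continuousMr => // y; exact: cvg_cst.
    + move=> y _; set X := (U (y, hn) - U (y, 0)) / hn; set Y := sin y * (sin hn / hn).
      have -> : F y hn / hn = X - Y.
        by rewrite /X /Y /F U0; field; exact: lt0r_neq0.
      have -> : 2 / hn ^+ 2 * (U (y, hn) - U (y, 0)) ^+ 2 = 2 * X ^+ 2.
        by rewrite /X; field; exact: lt0r_neq0.
      have Y1 : Y ^+ 2 <= 1.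
        rewrite -[leLHS]real_normK ?num_real// expr_le1//.
        rewrite /Y !normrM normfV (gtr0_norm hn0) mulr_ile1 ?sin_max//.
          by rewrite divr_ge0// ltW.
        by rewrite ler_pdivrMr// mul1r sin_le_id// ltW.
      exact: sqrB_le2.
  rewrite Rintegral_segmentD; last by move=> y; exact: cvg_cst.
  + rewrite Rintegral_segmentZ// Rintegral_cst//= lebesgue_measure_itv/= lte_fin.
    apply: lerD.
      rewrite mulrAC -mulrA ler_pM2l// ler_pdivrMr ?exprn_gt0// mulrC.
      have hT : 0 < hn < t + 1 by rewrite hn0 (le_lt_trans (ht n))// ltrDl.
      exact: (initial_increment_L2 cU U_weak ut_meas C0 ab utC hT).
    by case: ifPn => _ /=; rewrite ?mulr0// mulr_ge0// subr_ge0.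
  + by apply: continuousMr => // y; exact: cvg_cst.
Qed.

Let F_ge0 (y t : R) : 0 <= t -> 0 <= F y t.
Proof.
rewrite le_eqVlt => /predU1P[<-|t0]; first by rewrite F0.
by apply: superadditive_ge0 => // a b; exact: F_limit.
Qed.

(* On the triangle with base [pi + 2 pi m, 2 pi + 2 pi m] the apex value of w is
   -1/2, so u >= 0 makes D at least 1/2 there. *)
Lemma obstacle_lower_bound (n : nat) (x t : R) :
  pi + 2 * pi * n%:R <= x + t -> x - t <= pi -> 0 <= t -> n%:R / 2 - 1 / 2 <= u (x, t).
Proof.
have D_ge0 b a : b <= a -> 0 <= D b a.
  by move=> ba; apply: F_ge0; rewrite divr_ge0// subr_ge0.
have pi0 : 0 < (pi : R) := pi_gt0 R.
have cosp (m : nat) (y : R) : cos (y + 2 * pi * m%:R) = cos y.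
  have -> : y + 2 * pi * m%:R = y + (pi *+ 2) *+ m.
    by rewrite -(mulr_natr (pi *+ 2) m) -(mulr_natl pi 2).
  elim: m => [|m IH]; first by rewrite mulr0n addr0.
  by rewrite mulrSr addrA cosD2pi.
have D_period (m : nat) : 1 / 2 <= D (pi + 2 * pi * m%:R) (pi + 2 * pi * m.+1%:R).
  (* One period is cut into the triangle [b, c], which yields 1/2, and the rest [c, a], which
     contributes at least 0. *)
  pose c : R := 2 * pi + 2 * pi * m%:R; set b := pi + _; set a := pi + _.
  have bc : b <= c by rewrite /b /c; lra.
  have ca : c <= a.
    have mS : m.+1%:R = m%:R + 1 :> R by rewrite natr1.
    by rewrite /c /a mS; lra.
  have bca : b <= c <= a by rewrite bc ca.
  apply: le_trans (D_superadditive bca); apply: ler_wpDr; first exact: D_ge0.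
  rewrite DE /b /c !cosp.
  have -> : cos (2 * pi) = 1 :> R by rewrite mulr_natl cos2pi.
  by rewrite cospi; have := U_ge0 ((c + b) / 2, (c - b) / 2); rewrite /apex -/b -/c; lra.
have pi_le (m : nat) : pi <= pi + 2 * pi * m%:R :> R.
  by have m0 : 0 <= 2 * pi * m%:R :> R; [rewrite !mulr_ge0 ?(ltW pi0)|lra].
have D_growth : n%:R / 2 <= D pi (pi + 2 * pi * n%:R).
  elim: n => [|n IH]; first by rewrite mulr0 addr0 mul0r D_ge0.
  have ord : (pi : R) <= (pi : R) + 2 * pi * n%:R <= (pi : R) + 2 * pi * n.+1%:R.
    by rewrite pi_le lerD2l ler_pM2l ?mulr_gt0// ler_nat leqnSn.
  apply: le_trans (D_superadditive ord).
  have -> : n.+1%:R / 2 = n%:R / 2 + 1 / 2 :> R by rewrite -[n.+1%:R]natr1 mulrDl.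
  by apply: lerD.
move=> right left t0.
have Dxt : n%:R / 2 <= D (x - t) (x + t).
  have ord1 : x - t <= pi <= x + t.
    by rewrite left (le_trans (pi_le n) right).
  have ord2 : (pi : R) <= (pi : R) + 2 * pi * n%:R <= x + t.
    by rewrite right pi_le.
  apply: le_trans (D_superadditive ord1); apply: ler_wpDl; first by apply: D_ge0.
  apply: le_trans (D_superadditive ord2); apply: ler_wpDr => //.
  exact: D_ge0.
have -> : u (x, t) = D (x - t) (x + t) + 1 / 2 + sin x * sin t.
  rewrite /D (_ : (x + t + (x - t)) / 2 = x); last by field.
  rewrite (_ : (x + t - (x - t)) / 2 = t); last by field.
  by rewrite /F UE//=; ring.
have : `|sin x * sin t| <= 1 by rewrite normrM mulr_ile1 ?sin_max.
by rewrite ler_norml => /andP[s1 _]; move: Dxt s1; move: (D _ _) (sin x * sin t) => d s; lra.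
Qed.

End Obstacle.

Theorem mainTheorem4 (R : realType) (u : R * R -> R) :
  let u0 : R -> R := fun _ => 1 / 2 in
  let u1 : R -> R := fun x => sin x in
  let w : R * R -> R := fun p => 1 / 2 + sin p.1 * sin p.2 in
  obstacle_solution u0 u1 u ->
  [/\ free_wave u0 u1 w,
      forall x : R, u (x, t) @[t --> +oo] --> +oo &
      ~ (forall x t : R, 0 <= t ->
           u (x, t) = w (x, t) + 2 * sup (w^\- @` dependence_cone (x, t)))].
Proof.
move=> u0 u1 w [ux [ut [u_class u_obstacle u_init _]]].
have u_infty (x : R) : u (x, t) @[t --> +oo] --> +oo.
  apply/cvgryPge => A.
  have [n An] : exists n : nat, A <= n%:R / 2 - 1 / 2.
    exists (Num.bound `|2 * A + 1|).
    have : 2 * A + 1 <= (Num.bound `|2 * A + 1|)%:R.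
      by apply: le_trans (ler_norm _) (ltW _); exact: archi_boundP.
    by move: ((Num.bound _)%:R : R) => N; lra.
  near=> t; apply: le_trans An _.
  apply: (obstacle_lower_bound u_class u_obstacle u_init).
  - by rewrite -lerBlDl; near: t; apply: nbhs_pinfty_ge; exact: num_real.
  - by rewrite lerBlDr -lerBlDl; near: t; apply: nbhs_pinfty_ge; exact: num_real.
  - by near: t; apply: nbhs_pinfty_ge; exact: num_real.
split => //; first exact: free_wave_sin_sin.
move=> formula.
have sin_sin (p : R * R) : `|sin p.1 * sin p.2| <= 1 by rewrite normrM mulr_ile1 ?sin_max.
(* Here w lies between -1/2 and 3/2, so the formula would give at most 3/2 + 2 (1/2). The apex of
   the cone shows that the supremum is over a nonempty set. *)
have u_le (t : R) : 0 <= t -> u (0, t) <= 5 / 2.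
  move=> t0; rewrite formula//.
  have supw : sup (w^\- @` dependence_cone (0, t)) <= 1 / 2.
    apply: ge_sup.
      by exists (w^\- (0, t)); exists (0, t) => //; split; rewrite /= ?subrr ?normr0.
    move=> _ [p _ <-]; rewrite /funrneg ge_max; apply/andP; split; last by lra.
    by have := sin_sin p; rewrite ler_norml /w => /andP[? ?]; lra.
  by have := sin_sin (0, t); rewrite ler_norml /w/= => /andP[? ?]; lra.
have /cvgryPge/(_ 3) := u_infty 0.
move=> u3; near (pinfty_nbhs R) => t.
have : 3 <= u (0, t) by near: t.
have : u (0, t) <= 5 / 2 by apply: u_le; near: t; apply: nbhs_pinfty_ge; exact: num_real.
by move=> h1 h2; have := le_trans h2 h1; lra.
Unshelve. all: by end_near. Qed.
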